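(* In the setting below, let $T$ be an integral operator on $L^2(\mathbb{R}^d;\mu)$ with bounded kernel, and for $f,g\in L^2(\mathbb{R}^d;\mu)$ set $R_{(\omega_1,\omega_2)}(f,g)=(Tf_{bad},g)+(Tf_{good},g_{bad})$. Then $$\mathbb{E}\,|R_{(\omega_1,\omega_2)}(f,g)|\le2\delta\,\|T\|_{L^2(\mu)\to L^2(\mu)}\|f\|_{L^2(\mu)}\|g\|_{L^2(\mu)},$$ the expectation being over independent $\omega_1,\omega_2\in\Omega$.
   Context: Setting: $\mu$ a probability measure on $\mathbb{R}^d$ with compact support in $\frac14Q_*$, $Q_*$ a fixed unit cube; $H$ open. $\Omega=(-1/40,1/40]^d$ with normalized Lebesgue measure; $\mathcal{D}(\omega)$ is the set of dyadic subcubes of $\omega+Q_*$; $\mathcal{D}_1=\mathcal{D}(\omega_1)$, $\mathcal{D}_2=\mathcal{D}(\omega_2)$, $\omega_1,\omega_2$ independent. Terminal cubes: $2Q\subset H$ or $\mu(Q)=0$; transit otherwise. $\langle\psi\rangle_Q=\mu(Q)^{-1}\int_Q\psi\,d\mu$; $\Lambda\varphi=\langle\varphi\rangle$ over the whole support (the constant $\int\varphi\,d\mu$); for transit $Q$ with children $Q_j$: $\Delta_Q\varphi=0$ off $Q$, $=\langle\varphi\rangle_{Q_j}-\langle\varphi\rangle_Q$ on transit $Q_j$, $=\varphi-\langle\varphi\rangle_Q$ on terminal $Q_j$. Parameters $0<\tau\le1$, $m>0$, $\alpha=\tau/(2\tau+2m)$, $\delta>0$, $S\ge2$, $r$ with $2^{-r}\le\delta^S<2^{-r+1}$;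 $sk\,R=\bigcup_i\partial R_i$. $Q\in\mathcal{D}_1$ is bad if some $R\in\mathcal{D}_2$ has $\ell(R)\ge2^r\ell(Q)$ and $\operatorname{dist}(Q,sk\,R)<\ell(Q)^\alpha\ell(R)^{1-\alpha}$, good otherwise; symmetrically for $R\in\mathcal{D}_2$ relative to $\mathcal{D}_1$. $S$ and $\delta$ are chosen so that every fixed cube of one lattice is bad with probability at most $\delta^2$ over the shift of the other lattice. $f_{good}=\Lambda f+\sum_{Q\in\mathcal{D}_1\text{ transit, good}}\Delta_Qf$, $f_{bad}=\sum_{Q\in\mathcal{D}_1\text{ transit, bad}}\Delta_Qf$; $g_{good},g_{bad}$ likewise with $\mathcal{D}_2$. $(u,v)=\int u\bar v\,d\mu$. *)

(* Defs.v *)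
(* R : realType, R^d = d.-tuple R
   (with its product = Borel sigma-algebra), complex numbers R[i]. *)
From HB Require Import structures.
From mathcomp Require Import all_boot all_order all_algebra.
From mathcomp Require Import all_classical all_reals all_analysis.
From mathcomp.real_closed Require Import complex.
Import Order.TTheory GRing.Theory Num.Theory.

Set Implicit Arguments.
Unset Strict Implicit.
Unset Printing Implicit Defensive.

Local Open Scope ring_scope.
Local Open Scope classical_set_scope.

Section Defs.
Variable R : realType.
Variable d : nat.

Local Notation X := (d.-tuple R).

Definition cRe (z : R[i]) : R := @complex.Re R z.
Definition cIm (z : R[i]) : R := @complex.Im R z.
Definition cmod (z : R[i]) : R := Num.sqrt (cRe z ^+ 2 + cIm z ^+ 2).
Definition cconj (z : R[i]) : R[i] := Complex (cRe z) (- cIm z).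
Definition creal (t : R) : R[i] := Complex t 0.

Definition cubeS (a : 'I_d -> R) (l : R) : set X :=
  [set x | forall i, a i <= (tnth x i) < a i + l].
Definition doubleS (a : 'I_d -> R) (l : R) : set X :=
  cubeS (fun i => a i - l / 2) (2 * l).
Definition cube_boundary (a : 'I_d -> R) (l : R) : set X :=
  [set x | (forall i, a i <= (tnth x i) <= a i + l) /\
           exists i, (tnth x i) = a i \/ (tnth x i) = a i + l].
(* skeleton  sk Q = union of the boundaries of the 2^d children of Q *)
Definition skel (a : 'I_d -> R) (l : R) : set X :=
  [set x | exists e : 'I_d -> bool,
     cube_boundary (fun i => a i + (e i)%:R * (l / 2)) (l / 2) x].
Definition eucl (x y : X) : R := Num.sqrt (\sum_(i < d) ((tnth x i) - (tnth y i)) ^+ 2).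
Definition openbox (x : X) (rho : R) : set X :=
  [set y | forall i, `|(tnth y i) - (tnth x i)| < rho].
Definition openRd (H : set X) : Prop :=
  forall x, H x -> exists2 rho : R, 0 < rho & openbox x rho `<=` H.

(* ---------- the dyadic lattice D(w) of the cube w + Q_* ----------
   Q_* = c + [0,1)^d ; a cube of D(w) is indexed by its generation k and
   its position j (0 <= j_i < 2^k):  corner c + w + j 2^-k, side 2^-k. *)
Definition Omega : set X := [set w | forall i, -(1/40) < (tnth w i) <= 1/40].
Definition dside (k : nat) : R := (2 ^+ k)^-1.
Definition dcorner (c : 'I_d -> R) (w : X) (k : nat) (j : 'I_d -> nat) :
  'I_d -> R := fun i => c i + (tnth w i) + (j i)%:R * dside k.
Definition dvalid (k : nat) (j : 'I_d -> nat) : Prop :=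
  forall i, (j i < 2 ^ k)%N.
Definition dQ c w k j : set X := cubeS (dcorner c w k j) (dside k).
Definition dchild (j : 'I_d -> nat) (e : 'I_d -> bool) : 'I_d -> nat :=
  fun i => (2 * j i + e i)%N.

Variable mu : probability X R.

Definition supp : set X :=
  [set x | forall rho : R, 0 < rho -> (0 < mu (openbox x rho))%E].
(* supp mu is compact and contained in (1/4) Q_* = c + [3/8, 5/8)^d *)
Definition compact_supp_in_quarter (c : 'I_d -> R) : Prop :=
  supp `<=` cubeS (fun i => c i + 3 / 8) (1 / 4) /\
  exists M : R, forall x, supp x -> forall i, `|(tnth x i)| <= M.

Variable H : set X.
Variable c : 'I_d -> R.

Definition terminal w k j : Prop :=
  doubleS (dcorner c w k j) (dside k) `<=` H \/ mu (dQ c w k j) = 0%E.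
Definition transit w k j : Prop := ~ terminal w k j.

Definition alpha (tau m : R) : R := tau / (2 * tau + 2 * m).
Definition bad (tau m : R) (r : int) (w : X) k j (w' : X) : Prop :=
  exists k' j', dvalid k' j' /\
    powR 2 r%:~R * dside k <= dside k' /\
    exists x y, dQ c w k j x /\ skel (dcorner c w' k' j') (dside k') y /\
      eucl x y < powR (dside k) (alpha tau m) *
                 powR (dside k') (1 - alpha tau m).

Definition cint (A : set X) (h : X -> R[i]) : R[i] :=
  Complex (Rintegral mu A (fun x => cRe (h x))) (Rintegral mu A (fun x => cIm (h x))).
Definition avg (A : set X) (phi : X -> R[i]) : R[i] :=
  creal (fine (mu A))^-1 * cint A phi.
Definition Lam (phi : X -> R[i]) : X -> R[i] := fun _ => cint setT phi.

Definition Delta w k j (phi : X -> R[i]) : X -> R[i] := fun x =>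
  \sum_(e : {ffun 'I_d -> bool})
    (if `[< dQ c w k.+1 (dchild j e) x >] then
       (if `[< transit w k.+1 (dchild j e) >]
        then avg (dQ c w k.+1 (dchild j e)) phi - avg (dQ c w k j) phi
        else phi x - avg (dQ c w k j) phi)
     else 0).

Definition psum (sel : nat -> ('I_d -> nat) -> Prop) w (N : nat)
    (phi : X -> R[i]) : X -> R[i] := fun x =>
  \sum_(k < N.+1) \sum_(j : {ffun 'I_d -> 'I_(2 ^ k)%N})
    (if `[< transit w k (fun i => nat_of_ord (j i)) /\
             sel k (fun i => nat_of_ord (j i)) >]
     then Delta w k (fun i => nat_of_ord (j i)) phi x else 0).

Definition Sbad tau m r w w' N phi :=
  psum (fun k j => bad tau m r w k j w') w N phi.
Definition Sgood tau m r w w' N phi : X -> R[i] := fun x =>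
  Lam phi x + psum (fun k j => ~ bad tau m r w k j w') w N phi x.

Definition L2 (f : X -> R[i]) : Prop :=
  [/\ measurable_fun setT (fun x => cRe (f x)),
      measurable_fun setT (fun x => cIm (f x)) &
      (\int[mu]_x ((cmod (f x)) ^+ 2)%:E < +oo)%E].
Definition norm2 (f : X -> R[i]) : R :=
  Num.sqrt (fine (\int[mu]_x ((cmod (f x)) ^+ 2)%:E)%E).
Definition inner (u v : X -> R[i]) : R[i] := cint setT (fun x => u x * cconj (v x)).
Definition L2lim (S : nat -> X -> R[i]) (F : X -> R[i]) : Prop :=
  measurable_fun setT (fun x => cRe (F x)) /\
  measurable_fun setT (fun x => cIm (F x)) /\
  ((fun N => (\int[mu]_x ((cmod (S N x - F x)) ^+ 2)%:E)%E) @ \oo --> 0%E).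

Definition bounded_kernel (K : X -> X -> R[i]) : Prop :=
  measurable_fun setT (fun p : X * X => cRe (K p.1 p.2)) /\
  measurable_fun setT (fun p : X * X => cIm (K p.1 p.2)) /\
  exists C : R, forall x y, cmod (K x y) <= C.
Definition intop (K : X -> X -> R[i]) (f : X -> R[i]) : X -> R[i] :=
  fun x => cint setT (fun y => K x y * f y).
Definition opnorm (K : X -> X -> R[i]) : \bar R :=
  ereal_sup [set (norm2 (intop K f))%:E | f in [set f | L2 f /\ norm2 f <= 1]].

End Defs.

(* ---------- expectation over w uniform on Omega = (-1/40,1/40]^d ----------
   (normalized d-dimensional Lebesgue measure, written as an iterated
   integral over the coordinates) *)
Definition Om1 (R : realType) : set R := `](- (1/40)), (1/40 : R)].

Fixpoint itint (R : realType) (n : nat) : (n.-tuple R -> \bar R) -> \bar R :=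
  match n with
  | 0 => fun F => F [tuple]
  | n'.+1 => fun F =>
      ((20%:R : R)%:E *
       \int[@lebesgue_measure R]_(t in @Om1 R)
          @itint R n' (fun x => F (cons_tuple t x)))%E
  end.

(* Main.v *)
(* With [T] replaced by its norm and Cauchy-Schwarz, the remainder is at most
   [|T| (|f_bad| |g| + |f| |g_bad|)], since [|f_good| <= |f|]; so it suffices to show
   [E |f_bad|^2 <= delta^2 |f|^2] and the same for [g]. The differences [Delta_Q f] are
   pairwise orthogonal and orthogonal to constants: [Delta_Q f] has mean zero, is
   supported in [Q], and is constant on every transit cube strictly inside [Q].
   Hence [|f_bad|^2] is the sum of [|Delta_Q f|^2] over the bad transit cubes. For a
   fixed shift of its own lattice each cube is bad with probability at most [delta^2],
   and the sum of all [|Delta_Q f|^2] is at most [|f|^2] by Bessel.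

   For [g] the two expectations have to be exchanged, which requires joint
   measurability in the two shifts. Badness is an open condition on the difference of
   the shifts; being transit is a Borel condition because [H] is open and closed boxes
   are compact. The integrand of the theorem itself need not be measurable, but the
   integral is monotone on nonnegative functions in general. *)
Require Import Defs.
From HB Require Import structures.
From mathcomp Require Import all_boot all_order all_algebra.
From mathcomp Require Import all_classical all_reals all_analysis.
From mathcomp.real_closed Require Import complex.
From mathcomp Require Import measurable_realfun ring lra.
Import Order.TTheory GRing.Theory Num.Theory.
Local Open Scope ring_scope.
Local Open Scope classical_set_scope.

(** * Square-integrable real functions *)

Section SquareIntegrable.
Set Implicit Arguments.
Unset Strict Implicit.
Context {disp : measure_display} {T : measurableType disp} {R : realType}.
Variable mu : probability T R.
Implicit Types u v : T -> R.

Definition sqi u : Prop :=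
  measurable_fun setT u /\ mu.-integrable setT (EFin \o (fun x => u x ^+ 2)).
Definition ip u v : R := Rintegral mu setT (fun x => u x * v x).

(** The product is dominated by [u ^+ 2 + v ^+ 2], which is integrable. *)
Lemma sqi_mul u v : sqi u -> sqi v ->
  mu.-integrable setT (EFin \o (fun x => u x * v x)).
Proof.
move=> [mu_ iu] [mv iv].
apply: (@le_integrable _ _ _ _ _ measurableT _
   ((EFin \o (fun x => (u x ^+ 2)%R)) \+ (EFin \o (fun x => (v x ^+ 2)%R)))%E).
- by apply/measurable_EFinP; exact: measurable_funM.
- move=> x _ /=; rewrite lee_fin [leRHS]ger0_norm ?addr_ge0 ?sqr_ge0//.
  rewrite ler_norml; apply/andP; split; nra.
- exact: integrableD.
Qed.

Lemma sqi_cst a : sqi (cst a).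
Proof.
split=> //; exact: (finite_measure_integrable_cst _ (a ^+ 2)) measurableT.
Qed.

Lemma sqi_int u : sqi u -> mu.-integrable setT (EFin \o u).
Proof.
move=> su; apply: eq_integrable (sqi_mul su (sqi_cst 1)) => //.
by move=> x _ /=; rewrite mulr1.
Qed.

Lemma sqi_le u v : measurable_fun setT u -> sqi v ->
  (forall x, `|u x| <= `|v x|) -> sqi u.
Proof.
move=> mu_ [mv iv] uv; split=> //.
apply: le_integrable iv => //.
- by apply/measurable_EFinP; exact: measurable_funX.
- by move=> x _ /=; rewrite lee_fin !normrX lerXn2r ?nnegrE.
Qed.

Lemma sqiD u v : sqi u -> sqi v -> sqi (fun x => u x + v x).
Proof.
move=> su sv; case: (su) (sv) => mu_ iu [mv iv]; split.
  exact: measurable_funD.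
(* The majorant comes from [(u + v) ^+ 2 <= 2 * (u ^+ 2 + v ^+ 2)], that is, from
   [(u - v) ^+ 2 >= 0]. *)
apply: (@le_integrable _ _ _ _ _ measurableT _
   (fun x => (2 : R)%:E * ((EFin \o (fun x => (u x ^+ 2)%R)) \+ (EFin \o (fun x => (v x ^+ 2)%R)))%E x)%E).
- apply/measurable_EFinP; apply: measurable_funX; exact: measurable_funD.
- move=> x _ /=; rewrite lee_fin [leLHS]ger0_norm ?sqr_ge0//.
  rewrite [leRHS]ger0_norm ?mulr_ge0 ?addr_ge0 ?sqr_ge0//.
  have := sqr_ge0 (u x - v x); nra.
- exact: (integrableZl measurableT 2 (integrableD measurableT iu iv)).
Qed.

Lemma sqiZ a u : sqi u -> sqi (fun x => a * u x).
Proof.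
move=> [mu_ iu]; split; first exact: measurable_funM.
apply: eq_integrable (integrableZl measurableT (a ^+ 2) iu) => // x _ /=.
by rewrite -EFinM exprMn.
Qed.

Lemma sqiB u v : sqi u -> sqi v -> sqi (fun x => u x - v x).
Proof.
move=> su sv; rewrite (_ : (fun _ => _) = (fun x => u x + -1 * v x)).
  by apply: sqiD => //; exact: sqiZ.
by apply/funext => x; rewrite mulN1r.
Qed.

Lemma sqi_sum (I : Type) (s : seq I) (P : pred I) (F : I -> T -> R) :
  (forall i, sqi (F i)) -> sqi (fun x => \sum_(i <- s | P i) F i x).
Proof.
move=> sF; elim: s => [|i s IH].
  rewrite (_ : (fun _ => _) = cst 0); first exact: sqi_cst.
  by apply/funext => x; rewrite big_nil.
rewrite (_ : (fun _ => _) = (fun x => (if P i then F i x else 0) +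
   \sum_(i <- s | P i) F i x)).
  apply: sqiD => //; case: (P i) => //; exact: (sqi_cst 0).
by apply/funext => x; rewrite big_cons; case: (P i); rewrite ?add0r.
Qed.

Lemma sqi_indic A u : measurable A -> sqi u -> sqi (fun x => \1_A x * u x).
Proof.
move=> mA su; case: (su) => mu_ _; apply: (sqi_le _ su).
  apply: measurable_funM => //; exact: measurable_indic.
move=> x; rewrite normrM indicE; case: (x \in A); rewrite ?normr1 ?normr0 ?mul1r ?mul0r//.
Qed.

Lemma sqi_if (b : bool) u : sqi u -> sqi (fun x => if b then u x else 0).
Proof. by case: b => // _; exact: (sqi_cst 0). Qed.

Lemma ipC u v : ip u v = ip v u.
Proof. by apply: eq_Rintegral => x _; rewrite mulrC. Qed.

Lemma ipDl u v h : sqi u -> sqi v -> sqi h ->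
  ip (fun x => u x + v x) h = ip u h + ip v h.
Proof.
move=> su sv sh; rewrite /ip -RintegralD//; try exact: sqi_mul.
by apply: eq_Rintegral => x _; rewrite mulrDl.
Qed.

Lemma ipDr u v h : sqi u -> sqi v -> sqi h ->
  ip h (fun x => u x + v x) = ip h u + ip h v.
Proof. by move=> su sv sh; rewrite ipC ipDl// !(ipC h). Qed.

Lemma ip_sqrD u v : sqi u -> sqi v ->
  ip (fun x => u x + v x) (fun x => u x + v x) = ip u u + 2 * ip u v + ip v v.
Proof.
by move=> su sv; have suv := sqiD su sv; rewrite ipDl// !ipDr// (ipC v u); ring.
Qed.

Lemma ipZl a u h : sqi u -> sqi h -> ip (fun x => a * u x) h = a * ip u h.
Proof.
move=> su sh; rewrite /ip -RintegralZl//; try exact: sqi_mul.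
by apply: eq_Rintegral => x _; rewrite mulrA.
Qed.

Lemma ipZr a u h : sqi u -> sqi h -> ip h (fun x => a * u x) = a * ip h u.
Proof. by move=> su sh; rewrite ipC ipZl// ipC. Qed.

Lemma ipBl u v h : sqi u -> sqi v -> sqi h ->
  ip (fun x => u x - v x) h = ip u h - ip v h.
Proof.
move=> su sv sh; rewrite /ip -RintegralB//; try exact: sqi_mul.
by apply: eq_Rintegral => x _; rewrite mulrBl.
Qed.

Lemma ipBr u v h : sqi u -> sqi v -> sqi h ->
  ip h (fun x => u x - v x) = ip h u - ip h v.
Proof. by move=> su sv sh; rewrite ipC ipBl// !(ipC h). Qed.

Lemma ip0l h : ip (fun=> 0) h = 0.
Proof.
rewrite /ip (_ : (fun _ => _) = cst 0) ?Rintegral_cst ?mul0r//.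
by apply/funext => x; rewrite mul0r.
Qed.

Lemma ip_ifl (b : bool) u h : ip (fun x => if b then u x else 0) h = if b then ip u h else 0.
Proof. by case: b => //; exact: ip0l. Qed.

Lemma ip_suml (I : Type) (s : seq I) (P : pred I) (F : I -> T -> R) h :
  (forall i, sqi (F i)) -> sqi h ->
  ip (fun x => \sum_(i <- s | P i) F i x) h = \sum_(i <- s | P i) ip (F i) h.
Proof.
move=> sF sh; elim: s => [|i s IH].
  rewrite big_nil /ip (_ : (fun _ => _) = cst 0) ?Rintegral_cst ?mul0r//.
  by apply/funext => x; rewrite big_nil mul0r.
rewrite big_cons -IH; case: ifPn => Pi.
  rewrite -ipDl//; last exact: sqi_sum.
  by congr ip; apply/funext => x; rewrite big_cons Pi.
by congr ip; apply/funext => x; rewrite big_cons (negbTE Pi).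
Qed.

Lemma ip_ge0 u : 0 <= ip u u.
Proof. by apply: Rintegral_ge0 => x _; rewrite -expr2 sqr_ge0. Qed.

Lemma ip_cst a b : ip (cst a) (cst b) = a * b.
Proof.
rewrite /ip (_ : (fun _ => _) = cst (a * b)) ?Rintegral_cst//.
by rewrite [X in fine X]probability_setT /= mulr1.
Qed.

Lemma ip_indic A u : ip (\1_A) u = Rintegral mu A u.
Proof.
rewrite [RHS]Rintegral_mkcond; apply: eq_Rintegral => x _.
by rewrite patchE indicE; case: (x \in A); rewrite ?mul1r ?mul0r.
Qed.

Lemma sqi1 A : measurable A -> sqi (\1_A).
Proof.
move=> mA; have := sqi_indic mA (sqi_cst 1).
by rewrite (_ : (fun _ => _) = \1_A)//; apply/funext => x; rewrite /= mulr1.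
Qed.

Lemma ip_indic2 A : measurable A -> ip (\1_A) (\1_A) = fine (mu A).
Proof.
move=> mA; rewrite ip_indic /Rintegral integral_indic// setIid//.
Qed.

Lemma ip_square u : sqi u -> (\int[mu]_x (u x ^+ 2)%:E)%E = (ip u u)%:E.
Proof.
move=> [_ iu]; rewrite /ip /Rintegral fineK.
  by apply: eq_integral => x _; rewrite expr2.
apply: integrable_fin_num => //.
Qed.

(** The hypothesis says that [u - v] is orthogonal to [v], so the squared norm of [u - v] is
    [ip u u - ip v v]. This is how Bessel's inequality is obtained below. *)
Lemma ip_projection_le u v : sqi u -> sqi v -> ip u v = ip v v -> ip v v <= ip u u.
Proof.
move=> su sv uv; have suv := sqiB su sv.
have := ip_ge0 (fun x => u x - v x).
rewrite ipBl// ipBr// ipBr// uv (ipC v u) uv; lra.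
Qed.

End SquareIntegrable.

(** * Martingale differences on a dyadic lattice *)

Section MeasurableSets.
Set Implicit Arguments.
Unset Strict Implicit.
Context {disp : measure_display} {T : measurableType disp} {R : realType}.

Lemma measurable_forall_ord n (P : 'I_n -> set T) :
  (forall i, measurable (P i)) -> measurable [set t | forall i, P i t].
Proof.
move=> mP; rewrite (_ : [set t | _] = \bigcap_(i in setT) P i).
  by apply: fin_bigcap_measurable => //; exact: finite_finset.
by apply/seteqP; split => [t h i _|t h i]; exact: h.
Qed.

Lemma measurable_set_bool (b : T -> bool) :
  measurable_fun setT b -> measurable [set t | b t].
Proof. by move=> mb; rewrite -[X in measurable X]setTI; exact: mb. Qed.

Lemma measurable_cubeS d (a : 'I_d -> T -> R) (l : R) (x : T -> d.-tuple R) :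
  (forall i, measurable_fun setT (a i)) -> measurable_fun setT x ->
  measurable [set t | cubeS (fun i => a i t) l (x t)].
Proof.
move=> ma mx; apply: measurable_forall_ord => i; apply: measurable_set_bool.
have mxi : measurable_fun setT (fun t => tnth (x t) i).
  by apply: (measurableT_comp (measurable_tnth i)).
apply: measurable_and; first exact: measurable_fun_ler.
by apply: measurable_fun_ltr => //; exact: measurable_funD.
Qed.

End MeasurableSets.

Section DyadicCubes.
Set Implicit Arguments.
Unset Strict Implicit.
Context {R : realType} {d : nat}.
Variables (mu : probability (d.-tuple R) R) (H : set (d.-tuple R)).
Variables (c : 'I_d -> R) (w : d.-tuple R).
Local Notation X := (d.-tuple R).
Local Notation Q := (dQ c w).
Local Notation trans := (transit mu H c w).
Implicit Types (k : nat) (j : 'I_d -> nat) (e : {ffun 'I_d -> bool}).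

Lemma dsideS k : dside R k = 2 * dside R k.+1.
Proof. by rewrite /dside exprS invfM mulVKf. Qed.

Lemma dside_gt0 k : 0 < dside R k.
Proof. by rewrite invr_gt0 exprn_gt0. Qed.

(** After rescaling, [j i] is the integer part of the i-th coordinate. Disjointness and nesting of
    the cubes thus become arithmetic on integer parts. *)
Lemma dQP k j x : Q k j x <-> forall i, (j i)%:R <= (tnth x i - c i - tnth w i) * 2 ^+ k < (j i).+1%:R.
Proof.
have p k' : 0 < (2 : R) ^+ k' by rewrite exprn_gt0.
have E i : (dcorner c w k j i <= tnth x i < dcorner c w k j i + dside R k) =
    ((j i)%:R <= (tnth x i - c i - tnth w i) * 2 ^+ k < (j i).+1%:R).
  rewrite /dcorner /dside -ler_pdivrMr// -ltr_pdivlMr// -[(j i).+1%:R]natr1 mulrDl mul1r.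
  set t := _ / _; set l := _^-1.
  by congr (_ && _); apply/idP/idP; lra.
by split=> h i; have := h i; rewrite E.
Qed.

Lemma dQ_inj k j j' x : Q k j x -> Q k j' x -> j = j'.
Proof.
move=> /dQP h /dQP h'; apply/funext => i; have := h i; have := h' i.
move=> /andP[a b] /andP[a' b']; apply/eqP; rewrite eqn_leq; apply/andP.
by split; rewrite -ltnS -(ltr_nat R); [exact: le_lt_trans a' b|exact: le_lt_trans a b'].
Qed.

Lemma dchild_half j e : (fun i => (dchild j e i)./2) = j.
Proof.
by apply/funext => i; rewrite /dchild mul2n addnC half_bit_double.
Qed.

Lemma dQ_parent k j : Q k.+1 j `<=` Q k (fun i => (j i)./2).
Proof.
move=> x /dQP h; apply/dQP => i; have := h i.
set t := tnth x i - _ - _; rewrite exprS.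
have /(congr1 (fun n => n%:R : R)) := odd_double_half (j i).
rewrite -!natr1 natrD -mul2n natrM; set s := _ ^+ k.
by case: (odd _) => /= <- /andP[]; rewrite mulrA (mulrC t) -mulrA (mulrC t); lra.
Qed.

Lemma dQ_child_sub k j e : Q k.+1 (dchild j e) `<=` Q k j.
Proof. by move=> x /dQ_parent; rewrite dchild_half. Qed.

Lemma dQ_has_child k j x : Q k j x -> exists e, Q k.+1 (dchild j e) x.
Proof.
move=> /dQP h.
(* The bit [e i] records whether [x] lies in the upper half of the cube in direction [i]. *)
pose e := [ffun i => (2 * j i)%N.+1%:R <= (tnth x i - c i - tnth w i) * 2 ^+ k.+1].
exists e; apply/dQP => i; have := h i; rewrite /dchild ffunE.
set t := tnth x i - _ - _; rewrite exprS; set s := _ ^+ k.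
have S n : n.+1%:R = n%:R + 1 :> R by rewrite -natr1.
rewrite (_ : t * (2 * s) = 2 * (t * s)); last by ring.
have D : (2 * j i)%N%:R = 2 * (j i)%:R :> R by rewrite natrM.
rewrite (S (2 * j i)%N) (S (j i)) D.
case: (boolP (_ + 1 <= 2 * _)); rewrite -?ltNge => h1 /andP[h2 h3];
  rewrite ?addn0 ?addn1 ?(S (2 * j i)%N.+1) ?(S (2 * j i)%N) D; apply/andP; split; lra.
Qed.

(** Both ways of being terminal are inherited: the double of a child lies in the double of its
    parent, and a subset of a null cube is null. Hence all ancestors of a transit cube are
    transit. *)
Lemma terminal_child k j : terminal mu H c w k (fun i => (j i)./2) ->
  measurable (Q k.+1 j) -> measurable (Q k (fun i => (j i)./2)) ->
  terminal mu H c w k.+1 j.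
Proof.
move=> + m1 m2; case=> [sH|m0]; [left|right].
  apply: subset_trans sH => x h i; have := h i; rewrite /dcorner (dsideS k).
  move: (dside_gt0 k.+1); set l := dside R k.+1.
  have : (j i)%:R = (odd (j i))%:R + 2 * ((j i)./2)%:R :> R.
    by rewrite -[in LHS](odd_double_half (j i)) natrD -mul2n natrM.
  case: (odd _) => /= -> l0; set t := ((j i)./2)%:R;
    move=> /andP[a b]; apply/andP; split; lra.
apply/eqP; rewrite -measure_le0 -m0; apply: le_measure => //; rewrite ?inE//.
exact: dQ_parent.
Qed.


Lemma measurable_dQ k j : measurable (Q k j).
Proof. by apply: (@measurable_cubeS _ _ _ _ _ _ id) => // i; exact: measurable_cst. Qed.
Hint Resolve measurable_dQ : core.

Lemma transit_parent k j : trans k.+1 j -> trans k (fun i => (j i)./2).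
Proof. by move=> tr te; apply: tr; exact: terminal_child. Qed.

Lemma transit_gt0 k j : trans k j -> fine (mu (Q k j)) != 0.
Proof.
move=> tr; apply/eqP => m0; apply: tr; right; rewrite -[RHS]/(0%:E) -m0 fineK//.
exact: fin_num_measure.
Qed.

Lemma dchild_inj j : injective (fun e : {ffun 'I_d -> bool} => dchild j e).
Proof.
move=> e e' ee; apply/ffunP => i.
have /addnI := congr1 (fun f => f i) ee.
by case: (e i); case: (e' i).
Qed.

Definition ravg (A : set X) (u : X -> R) : R :=
  (fine (mu A))^-1 * Rintegral mu A u.

Definition rDelta k j (u : X -> R) : X -> R := fun x =>
  \sum_(e : {ffun 'I_d -> bool})
    (if `[< Q k.+1 (dchild j e) x >] then
       (if `[< trans k.+1 (dchild j e) >]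
        then ravg (Q k.+1 (dchild j e)) u - ravg (Q k j) u
        else u x - ravg (Q k j) u)
     else 0).

(** What the stopped averaging puts on a cube: the mean on a transit cube, and [u] itself once a
    terminal cube is reached. *)
Definition stop_avg k j (u : X -> R) : X -> R :=
  if `[< trans k j >] then cst (ravg (Q k j) u) else u.

(** The orthogonal projection of [u] onto the functions living on the cube that are constant on its
    transit children and arbitrary on its terminal ones. *)
Definition next_avg k j (u : X -> R) : X -> R := fun x =>
  \sum_(e : {ffun 'I_d -> bool})
    \1_(Q k.+1 (dchild j e)) x * stop_avg k.+1 (dchild j e) u x.

Lemma sum_indic_child k j x :
  \sum_(e : {ffun 'I_d -> bool}) \1_(Q k.+1 (dchild j e)) x = \1_(Q k j) x :> R.
Proof.
rewrite [RHS]indicE; case: (pselect (Q k j x)) => [/[dup] Qx|nQ].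
  move=> /dQ_has_child[e0 Qe0]; rewrite mem_set// (bigD1 e0)//= indicE mem_set//.
  rewrite big1 ?addr0// => e ne; rewrite indicE memNset//.
  by move=> /(dQ_inj Qe0)/dchild_inj e0e; rewrite e0e eqxx in ne.
rewrite memNset//= big1// => e _; rewrite indicE memNset//.
by move=> /dQ_child_sub.
Qed.

Lemma indic_next_avg k j e u x :
  \1_(Q k.+1 (dchild j e)) x * next_avg k j u x =
  \1_(Q k.+1 (dchild j e)) x * stop_avg k.+1 (dchild j e) u x :> R.
Proof.
rewrite indicE; case: (pselect (Q k.+1 (dchild j e) x)) => Qx; last first.
  by rewrite memNset// !mul0r.
rewrite mem_set// !mul1r /next_avg (bigD1 e)//= indicE mem_set// mul1r.
rewrite big1 ?addr0// => e' ne; rewrite indicE memNset ?mul0r//.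
by move=> /(dQ_inj Qx)/dchild_inj ee; rewrite ee eqxx in ne.
Qed.

(** This writes the martingale difference as a difference of two averages of [u], one adapted to the
    children and one to the cube, so that its mean and norm can be read off from theirs. *)
Lemma rDeltaE k j u x :
  rDelta k j u x = next_avg k j u x - ravg (Q k j) u * \1_(Q k j) x.
Proof.
rewrite -sum_indic_child mulr_sumr -sumrB; apply: eq_bigr => e _.
rewrite /stop_avg indicE; case: asboolP => Qx; last first.
  by rewrite memNset// mul0r mulr0 subr0.
by rewrite mem_set// mul1r mulr1; case: ifP.
Qed.

Lemma rDelta_out k j u x : ~ Q k j x -> rDelta k j u x = 0.
Proof.
move=> nQ; apply: big1 => e _; case: asboolP => // /dQ_child_sub//.
Qed.

(** Cubes of one generation are disjoint, so only a child equal to the given cube can contribute;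
    being transit, it contributes a difference of means, which is a constant. *)
Lemma rDelta_const k j j' u x y : trans k.+1 j -> Q k.+1 j x -> Q k.+1 j y ->
  rDelta k j' u x = rDelta k j' u y.
Proof.
move=> tr Qx Qy; apply: eq_bigr => e _.
have [<-|ne] := pselect (j = dchild j' e).
  by rewrite (asboolT Qx) (asboolT Qy) (asboolT tr).
have nQ z : Q k.+1 j z -> ~ Q k.+1 (dchild j' e) z by move=> h1 /(dQ_inj h1).
by rewrite (asboolF (nQ x Qx)) (asboolF (nQ y Qy)).
Qed.

(** * Orthogonality of the differences and Bessel's inequality *)

Section Bessel.
Variable u : X -> R.
Hypothesis su : sqi mu u.

Lemma sqi_stop_avg k j : sqi mu (stop_avg k j u).
Proof. by rewrite /stop_avg; case: ifP => // _; exact: sqi_cst. Qed.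
Hint Resolve sqi_stop_avg : core.

Lemma sqi_next_avg k j : sqi mu (next_avg k j u).
Proof. by apply: sqi_sum => e; exact: sqi_indic. Qed.
Hint Resolve sqi_next_avg : core.

Lemma sqi_rDelta k j : sqi mu (rDelta k j u).
Proof.
rewrite (_ : rDelta k j u = (fun x => next_avg k j u x - ravg (Q k j) u * \1_(Q k j) x)).
  by apply: sqiB => //; apply: sqiZ; exact: sqi1.
by apply/funext => x; exact: rDeltaE.
Qed.
Hint Resolve sqi_rDelta : core.

Lemma ravg_mass k j : trans k j -> ravg (Q k j) u * fine (mu (Q k j)) = ip mu (\1_(Q k j)) u.
Proof.
by move=> /transit_gt0 m0; rewrite /ravg ip_indic mulrAC mulVf// mul1r.
Qed.

Lemma ip_stop_avg k j : ip mu (\1_(Q k j)) (stop_avg k j u) = ip mu (\1_(Q k j)) u.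
Proof.
rewrite /stop_avg; case: asboolP => // tr; rewrite -ravg_mass// -ip_indic2//.
rewrite -ipZr; try exact: sqi1.
by apply: eq_Rintegral => x _ /=; rewrite indicE; case: (_ \in _); rewrite ?mulr1 ?mul1r ?mul0r.
Qed.

(** The projection identity on a single cube: trivial on a terminal cube, and on a transit cube a
    consequence of the mean having the same mass as [u]. *)
Lemma ip_stop_avg2 k j :
  ip mu (fun x => \1_(Q k j) x * stop_avg k j u x) (stop_avg k j u) =
  ip mu (fun x => \1_(Q k j) x * stop_avg k j u x) u.
Proof.
have := ip_stop_avg k j; rewrite /stop_avg; case: asboolP => // tr e.
have s1 := sqi1 mu (measurable_dQ k j).
rewrite (_ : (fun x => \1_(Q k j) x * _) = (fun x => ravg (Q k j) u * \1_(Q k j) x)).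
  by rewrite !ipZl ?e//; exact: sqi_cst.
by apply/funext => x /=; rewrite mulrC.
Qed.

Lemma ip_next_avg_indic k j : ip mu (next_avg k j u) (\1_(Q k j)) = ip mu (\1_(Q k j)) u.
Proof.
have s1 k' j' := sqi1 mu (measurable_dQ k' j').
rewrite ip_suml//; last by move=> e; exact: sqi_indic.
rewrite (_ : \1_(Q k j) = fun x => \sum_(e : {ffun 'I_d -> bool}) \1_(Q k.+1 (dchild j e)) x); last first.
  by apply/funext => x; rewrite sum_indic_child.
rewrite ip_suml//; apply: eq_bigr => e _; rewrite -ip_stop_avg.
apply: eq_Rintegral => x _ /=; rewrite sum_indic_child !indicE.
case: (pselect (Q k.+1 (dchild j e) x)) => Qx; last by rewrite memNset// !mul0r.
by rewrite (mem_set (dQ_child_sub Qx)) mulr1.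
Qed.

(** The children are disjoint, so the projection identity can be summed over them. *)
Lemma ip_next_avg2 k j : ip mu (next_avg k j u) (next_avg k j u) = ip mu (next_avg k j u) u.
Proof.
rewrite [in LHS](_ : ip mu _ _ = ip mu (fun x => \sum_(e : {ffun 'I_d -> bool})
    \1_(Q k.+1 (dchild j e)) x * stop_avg k.+1 (dchild j e) u x) (next_avg k j u))//.
rewrite !ip_suml//; try by move=> e; exact: sqi_indic.
apply: eq_bigr => e _; rewrite -ip_stop_avg2; apply: eq_Rintegral => x _ /=.
by rewrite mulrAC indic_next_avg mulrAC.
Qed.

(** Mean zero: [next_avg] and the average over the cube both carry the mass of [u] on that cube. *)
Lemma ip_rDelta_indic k j : trans k j -> ip mu (rDelta k j u) (\1_(Q k j)) = 0.
Proof.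
move=> tr; have s1 := sqi1 mu (measurable_dQ k j).
rewrite (_ : rDelta k j u = (fun x => next_avg k j u x - ravg (Q k j) u * \1_(Q k j) x)).
  by rewrite ipBl// ?ipZl ?ip_next_avg_indic// ?ip_indic2 ?ravg_mass ?subrr//; exact: sqiZ.
by apply/funext => x; exact: rDeltaE.
Qed.

(** [rDelta] acts as an orthogonal projection. Mean zero removes the term with the average from the
    left side, and the projection identity for [next_avg] settles the rest. *)
Lemma ip_rDelta2 k j : trans k j ->
  ip mu (rDelta k j u) (rDelta k j u) = ip mu (rDelta k j u) u.
Proof.
move=> tr; have s1 := sqi1 mu (measurable_dQ k j).
have z := ip_rDelta_indic tr.
have E : rDelta k j u = (fun x => next_avg k j u x - ravg (Q k j) u * \1_(Q k j) x).
  by apply/funext => x; exact: rDeltaE.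
rewrite {2}E ipBr// ?ipZr ?z//; last exact: sqiZ.
rewrite E !ipBl ?ipZl//; try exact: sqiZ.
by rewrite ip_next_avg2 (ipC _ (\1_ _)) ip_next_avg_indic mulr0 subr0.
Qed.

Variable sel : nat -> ('I_d -> nat) -> Prop.

Definition gen_sum k : X -> R := fun x =>
  \sum_(j : {ffun 'I_d -> 'I_(2 ^ k)%N})
    (if `[< trans k (fun i => nat_of_ord (j i)) /\ sel k (fun i => nat_of_ord (j i)) >]
     then rDelta k (fun i => nat_of_ord (j i)) u x else 0).

(** The constant [a] lets one computation serve both parts of a function: [a = 0] gives the bad
    part, the mean of [u] gives the good part or the full expansion. Generations strictly below [n]
    are summed. *)
Definition rpsum (a : R) n : X -> R := fun x => a + \sum_(k < n) gen_sum k x.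

Lemma sqi_gen_sum k : sqi mu (gen_sum k).
Proof.
by apply: sqi_sum => j; exact: sqi_if.
Qed.

Lemma sqi_rpsum a n : sqi mu (rpsum a n).
Proof.
by apply: sqiD; [exact: sqi_cst|apply: sqi_sum => k; exact: sqi_gen_sum].
Qed.
Hint Resolve sqi_gen_sum sqi_rpsum : core.

Lemma rpsumS a n x : rpsum a n.+1 x = rpsum a n x + gen_sum n x.
Proof. by rewrite /rpsum big_ord_recr addrA. Qed.

(** Climbing through the ancestors, all of them transit, every difference of an earlier generation
    is constant on the given cube. *)
Lemma rpsum_const a n j x y : trans n j -> Q n j x -> Q n j y ->
  rpsum a n x = rpsum a n y.
Proof.
elim: n j => [|n IH] j tr Qx Qy; first by rewrite /rpsum !big_ord0.
rewrite !rpsumS (IH _ (transit_parent tr) (dQ_parent Qx) (dQ_parent Qy)).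
congr (_ + _); apply: eq_bigr => j' _; case: ifP => // _; exact: rDelta_const Qx Qy.
Qed.

(** On the support of the difference the earlier sum is a constant, which factors out and meets mean
    zero. *)
Lemma ip_rpsum_rDelta a n j : trans n j -> ip mu (rpsum a n) (rDelta n j u) = 0.
Proof.
move=> tr; have s1 := sqi1 mu (measurable_dQ n j).
have [[y Qy]|nQ] := pselect (exists y, Q n j y).
  rewrite -(mulr0 (rpsum a n y)) -(ip_rDelta_indic tr) -ipZl// ipC.
  apply: eq_Rintegral => x _ /=.
  have [Qx|nQx] := pselect (Q n j x); last by rewrite rDelta_out// mulr0 !mul0r.
  by rewrite (rpsum_const a tr Qx Qy) indicE mem_set// mulr1 mulrC.
rewrite /ip (_ : (fun _ => _) = cst 0) ?Rintegral_cst ?mul0r//.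
apply/funext => x; rewrite rDelta_out ?mulr0// => Qx; apply: nQ; by exists x.
Qed.

(** Differences of the same generation have disjoint supports, so only the term of [j] itself
    survives. *)
Lemma ip_gen_sum_rDelta n (j : {ffun 'I_d -> 'I_(2 ^ n)%N}) :
  trans n (fun i => nat_of_ord (j i)) /\ sel n (fun i => nat_of_ord (j i)) ->
  ip mu (gen_sum n) (rDelta n (fun i => nat_of_ord (j i)) u) =
  ip mu (rDelta n (fun i => nat_of_ord (j i)) u) (rDelta n (fun i => nat_of_ord (j i)) u).
Proof.
move=> tj; apply: eq_Rintegral => x _.
have [Qx|nQx] := pselect (Q n (fun i => nat_of_ord (j i)) x); last first.
  by rewrite rDelta_out// !mulr0.
congr (_ * _); rewrite /gen_sum (bigD1 j)//= ifT ?big1 ?addr0//; last exact/asboolP.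
move=> j' ne; case: ifP => // _; apply: rDelta_out => Qx'.
case/eqP: ne; apply/ffunP => i; apply/val_inj.
exact: (congr1 (fun f => f i) (dQ_inj Qx' Qx)).
Qed.

(** Pythagoras, one generation at a time: the new generation is orthogonal to the sum of the earlier
    ones, and its own terms are pairwise orthogonal. *)
Lemma ip_rpsum2 a n : ip mu (rpsum a n) (rpsum a n) = a ^+ 2 +
  \sum_(k < n) \sum_(j : {ffun 'I_d -> 'I_(2 ^ k)%N})
    (if `[< trans k (fun i => nat_of_ord (j i)) /\ sel k (fun i => nat_of_ord (j i)) >]
     then ip mu (rDelta k (fun i => nat_of_ord (j i)) u)
                (rDelta k (fun i => nat_of_ord (j i)) u) else 0).
Proof.
elim: n => [|n IH].
  rewrite big_ord0 addr0 (_ : rpsum a 0 = cst a) ?ip_cst//.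
  by apply/funext => x; rewrite /rpsum big_ord0 addr0.
have -> : rpsum a n.+1 = (fun x => rpsum a n x + gen_sum n x).
  by apply/funext => x; rewrite rpsumS.
rewrite (ip_sqrD (sqi_rpsum a n) (sqi_gen_sum n)).
have tsum h : sqi mu h -> ip mu h (gen_sum n) =
  \sum_(j : {ffun 'I_d -> 'I_(2 ^ n)%N})
    (if `[< trans n (fun i => nat_of_ord (j i)) /\ sel n (fun i => nat_of_ord (j i)) >]
     then ip mu h (rDelta n (fun i => nat_of_ord (j i)) u) else 0).
  move=> sh; rewrite ipC ip_suml//; last by move=> j; exact: sqi_if.
  by apply: eq_bigr => j _; rewrite ip_ifl (ipC _ _ h).
rewrite big_ord_recr [in RHS]addrA -IH /=.
have -> : ip mu (rpsum a n) (gen_sum n) = 0.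
  by rewrite tsum// big1// => j _; case: asboolP => // -[tr _]; exact: ip_rpsum_rDelta.
rewrite mulr0 addr0; congr (_ + _); rewrite tsum//; apply: eq_bigr => j _.
by case: asboolP => // h; exact: ip_gen_sum_rDelta.
Qed.

End Bessel.

(** The left side is the squared norm of the partial sum [p] that selects all transit cubes and
    starts from the mean. By [ip_rDelta2], pairing [p] with [u] gives the same number, so
    [ip_projection_le] applies. *)
Lemma bessel u n : sqi mu u ->
  (Rintegral mu setT u) ^+ 2 +
  \sum_(k < n) \sum_(j : {ffun 'I_d -> 'I_(2 ^ k)%N})
    (if `[< trans k (fun i => nat_of_ord (j i)) >]
     then ip mu (rDelta k (fun i => nat_of_ord (j i)) u)
                (rDelta k (fun i => nat_of_ord (j i)) u) else 0) <= ip mu u u.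
Proof.
move=> su; pose a := Rintegral mu setT u.
have e := ip_rpsum2 su (fun _ _ => True) a n.
rewrite [leLHS](_ : _ = ip mu (rpsum u (fun _ _ => True) a n) (rpsum u (fun _ _ => True) a n)).
  apply: ip_projection_le => //; first exact: sqi_rpsum.
  rewrite e ipC ipDl//; [|exact: sqi_cst|by apply: sqi_sum => k; exact: sqi_gen_sum].
  congr (_ + _).
    rewrite /ip (_ : (fun _ => _) = (fun x => a * u x))// RintegralZl ?expr2//.
    exact: sqi_int.
  rewrite ip_suml//; last by move=> k; exact: sqi_gen_sum.
  apply: eq_bigr => k _; rewrite ip_suml//; last by move=> j; apply: sqi_if; exact: sqi_rDelta.
  by apply: eq_bigr => j _; rewrite ip_ifl; case: asboolP => // -[tr _]; rewrite ip_rDelta2.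
rewrite e; congr (_ + _); apply: eq_bigr => k _; apply: eq_bigr => j _.
by congr (if _ then _ else _); apply/asbool_equiv_eq; split => [|[]].
Qed.

End DyadicCubes.

(** * Complex square-integrable functions *)

Section ComplexL2.
Set Implicit Arguments.
Unset Strict Implicit.
Context {R : realType} {d : nat}.
Local Notation X := (d.-tuple R).
Variable mu : probability X R.
Implicit Types (f u v : X -> R[i]) (z : R[i]).
Local Notation re u := (fun x => cRe (u x)).
Local Notation im u := (fun x => cIm (u x)).

Lemma cReD z z' : cRe (z + z') = cRe z + cRe z'.
Proof. by case: z z' => [a b] [a' b']. Qed.
Lemma cImD z z' : cIm (z + z') = cIm z + cIm z'.
Proof. by case: z z' => [a b] [a' b']. Qed.
Lemma cReB z z' : cRe (z - z') = cRe z - cRe z'.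
Proof. by case: z z' => [a b] [a' b']. Qed.
Lemma cImB z z' : cIm (z - z') = cIm z - cIm z'.
Proof. by case: z z' => [a b] [a' b']. Qed.
Lemma cReM z z' : cRe (z * z') = cRe z * cRe z' - cIm z * cIm z'.
Proof. by case: z z' => [a b] [a' b']. Qed.
Lemma cImM z z' : cIm (z * z') = cRe z * cIm z' + cIm z * cRe z'.
Proof. by case: z z' => [a b] [a' b']. Qed.

Lemma cRe_sum (I : Type) (s : seq I) (P : pred I) (F : I -> R[i]) :
  cRe (\sum_(i <- s | P i) F i) = \sum_(i <- s | P i) cRe (F i).
Proof. exact: (big_morph _ cReD (erefl _)). Qed.
Lemma cIm_sum (I : Type) (s : seq I) (P : pred I) (F : I -> R[i]) :
  cIm (\sum_(i <- s | P i) F i) = \sum_(i <- s | P i) cIm (F i).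
Proof. exact: (big_morph _ cImD (erefl _)). Qed.

Lemma cmod2 z : cmod z ^+ 2 = cRe z ^+ 2 + cIm z ^+ 2.
Proof. by rewrite /cmod sqr_sqrtr// addr_ge0 ?sqr_ge0. Qed.

Lemma cmod_ge0 z : 0 <= cmod z. Proof. exact: sqrtr_ge0. Qed.

Lemma cmodM z z' : cmod (z * z') = cmod z * cmod z'.
Proof.
apply/eqP; rewrite -(@eqrXn2 _ 2)// ?mulr_ge0 ?cmod_ge0// exprMn !cmod2 cReM cImM.
by apply/eqP; ring.
Qed.

Lemma cmodD z z' : cmod (z + z') <= cmod z + cmod z'.
Proof.
rewrite -(@ler_pXn2r _ 2) ?nnegrE ?addr_ge0 ?cmod_ge0// sqrrD !cmod2 cReD cImD.
suff : cRe z * cRe z' + cIm z * cIm z' <= cmod z * cmod z' by lra.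
have [n|/ltW p] := leP (cRe z * cRe z' + cIm z * cIm z') 0.
  by apply: le_trans n _; rewrite mulr_ge0 ?cmod_ge0.
rewrite -(@ler_pXn2r _ 2) ?nnegrE ?mulr_ge0 ?cmod_ge0// exprMn !cmod2.
have := sqr_ge0 (cRe z * cIm z' - cIm z * cRe z'); lra.
Qed.

Lemma cRe_le_cmod z : `|cRe z| <= cmod z.
Proof.
by rewrite -(@ler_pXn2r _ 2) ?nnegrE ?cmod_ge0// cmod2 real_normK ?num_real// lerDl sqr_ge0.
Qed.
Lemma cIm_le_cmod z : `|cIm z| <= cmod z.
Proof.
by rewrite -(@ler_pXn2r _ 2) ?nnegrE ?cmod_ge0// cmod2 real_normK ?num_real// lerDr sqr_ge0.
Qed.

Definition nsq u : R := ip mu (re u) (re u) + ip mu (im u) (im u).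

Lemma nsq_ge0 u : 0 <= nsq u.
Proof. by rewrite addr_ge0 ?ip_ge0. Qed.

Lemma nsqE u : sqi mu (re u) -> sqi mu (im u) ->
  (\int[mu]_x ((cmod (u x)) ^+ 2)%:E)%E = (nsq u)%:E.
Proof.
move=> sr si; rewrite EFinD -!ip_square//.
rewrite -ge0_integralD//.
- by apply: eq_integral => x _; rewrite cmod2 EFinD.
- by move=> x _; rewrite lee_fin sqr_ge0.
- by apply/measurable_EFinP; apply: measurable_funX; case: sr.
- by move=> x _; rewrite lee_fin sqr_ge0.
- by apply/measurable_EFinP; apply: measurable_funX; case: si.
Qed.

Lemma measurable_cmod2 u : measurable_fun setT (re u) -> measurable_fun setT (im u) ->
  measurable_fun setT (fun x => cmod (u x) ^+ 2).
Proof.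
move=> mr mi; rewrite (_ : (fun x => _) = (fun x => cRe (u x) ^+ 2 + cIm (u x) ^+ 2)).
  by apply: measurable_funD; exact: measurable_funX.
by apply/funext => x; rewrite cmod2.
Qed.

Lemma L2_sqi u : L2 mu u -> sqi mu (re u) /\ sqi mu (im u).
Proof.
move=> [mr mi fin].
have I : mu.-integrable setT (EFin \o (fun x => cmod (u x) ^+ 2)).
  apply/integrableP; split; first by apply/measurable_EFinP; exact: (measurable_cmod2 mr mi).
  rewrite (eq_integral (fun x => (cmod (u x) ^+ 2)%:E))// => x _ /=.
  by rewrite ger0_norm ?sqr_ge0.
split; split => //.
- apply: (le_integrable measurableT _ _ I).
    by apply/measurable_EFinP; exact: measurable_funX.
  move=> x _ /=; rewrite lee_fin !ger0_norm ?sqr_ge0//.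
  by rewrite cmod2 lerDl sqr_ge0.
- apply: (le_integrable measurableT _ _ I).
    by apply/measurable_EFinP; exact: measurable_funX.
  move=> x _ /=; rewrite lee_fin !ger0_norm ?sqr_ge0//.
  by rewrite cmod2 lerDr sqr_ge0.
Qed.

Lemma sqi_L2 u : sqi mu (re u) -> sqi mu (im u) -> L2 mu u.
Proof.
by move=> sr si; case: (sr) (si) => mr _ [mi _]; split => //; rewrite nsqE// ltry.
Qed.

Lemma norm2E u : L2 mu u -> norm2 mu u = Num.sqrt (nsq u).
Proof. by move=> /L2_sqi[sr si]; rewrite /norm2 nsqE. Qed.

Lemma norm2_ge0 u : 0 <= norm2 mu u. Proof. exact: sqrtr_ge0. Qed.

Lemma norm2_sqr u : L2 mu u -> norm2 mu u ^+ 2 = nsq u.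
Proof. by move=> /norm2E ->; rewrite sqr_sqrtr// nsq_ge0. Qed.

(** In real and imaginary parts separately, the right side minus the left is a positive multiple of
    a perfect square. *)
Lemma cmod2_young (e : R) z z' : 0 < e ->
  cmod z' ^+ 2 <= (1 + e) * cmod z ^+ 2 + (1 + e^-1) * cmod (z - z') ^+ 2.
Proof.
move=> e0; rewrite !cmod2 cReB cImB.
have h (a b : R) : b ^+ 2 <= (1 + e) * a ^+ 2 + (1 + e^-1) * (a - b) ^+ 2.
  rewrite -subr_ge0 (_ : _ - _ = e^-1 * (e * a + (a - b)) ^+ 2).
    by rewrite mulr_ge0 ?sqr_ge0// invr_ge0 ltW.
  by field; rewrite gt_eqF.
have := h (cRe z) (cRe z'); have := h (cIm z) (cIm z'); lra.
Qed.

(** The weighted triangle inequality [cmod2_young] transfers the bound to the limit: the error term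
    vanishes along the sequence, after which [e] may be taken arbitrarily small. Finiteness of the
    norm of [F] is part of the conclusion. *)
Lemma L2lim_bound (S : nat -> X -> R[i]) F (b : R) :
  L2lim mu S F -> (forall N, L2 mu (S N)) -> (forall N, nsq (S N) <= b) ->
  L2 mu F /\ nsq F <= b.
Proof.
move=> [mr [mi cv]] LS Sb.
have mD N : measurable_fun setT (fun x => cmod (S N x - F x) ^+ 2).
  have [msr msi _] := LS N.
  have m1 : measurable_fun setT (fun x => cRe (S N x - F x)).
    rewrite (_ : (fun x => _) = fun x => cRe (S N x) - cRe (F x)).
      exact: measurable_funB.
    by apply/funext => x; rewrite cReB.
  have m2 : measurable_fun setT (fun x => cIm (S N x - F x)).
    rewrite (_ : (fun x => _) = fun x => cIm (S N x) - cIm (F x)).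
      exact: measurable_funB.
    by apply/funext => x; rewrite cImB.
  exact: (measurable_cmod2 m1 m2).
have young (e : R) N : 0 < e -> (\int[mu]_x ((cmod (F x)) ^+ 2)%:E <=
   ((1 + e) * b)%:E + (1 + e^-1)%:E * \int[mu]_x ((cmod (S N x - F x)) ^+ 2)%:E)%E.
  move=> e0; have e1 : 0 <= 1 + e by lra.
  have e2 : 0 <= 1 + e^-1 by rewrite addr_ge0// invr_ge0 ltW.
  have [msr msi _] := LS N.
  apply: (@le_trans _ _ (\int[mu]_x ((1 + e)%:E * ((cmod (S N x)) ^+ 2)%:E +
     (1 + e^-1)%:E * ((cmod (S N x - F x)) ^+ 2)%:E))%E).
    apply: ge0_le_integral => //.
    - by move=> x _; rewrite lee_fin sqr_ge0.
    - by apply/measurable_EFinP; exact: (measurable_cmod2 mr mi).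
    - apply: emeasurable_funD; apply: measurable_funeM; apply/measurable_EFinP => //.
      exact: (measurable_cmod2 msr msi).
    - by move=> x _; rewrite -!EFinM -EFinD lee_fin cmod2_young.
  rewrite ge0_integralD//.
  - rewrite ge0_integralZl//; last 2 first.
    + by apply/measurable_EFinP; exact: (measurable_cmod2 msr msi).
    + by move=> x _; rewrite lee_fin sqr_ge0.
    rewrite ge0_integralZl//; last 2 first.
    + by apply/measurable_EFinP.
    + by move=> x _; rewrite lee_fin sqr_ge0.
    have [sr si] := L2_sqi (LS N).
    by rewrite leeD// nsqE// -EFinM lee_fin ler_wpM2l.
  - by move=> x _; rewrite -EFinM lee_fin mulr_ge0 ?sqr_ge0.
  - by apply: measurable_funeM; by apply/measurable_EFinP; exact: (measurable_cmod2 msr msi).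
  - by move=> x _; rewrite -EFinM lee_fin mulr_ge0 ?sqr_ge0.
  - by apply: measurable_funeM; by apply/measurable_EFinP.
have small (e : R) : 0 < e -> exists N, (\int[mu]_x ((cmod (S N x - F x)) ^+ 2)%:E <= e%:E)%E.
  move=> e0; apply/not_existsP => h.
  have cvn : cvgn (fun N => (\int[mu]_x ((cmod (S N x - F x)) ^+ 2)%:E)%E).
    by apply/cvg_ex; exists 0%E.
  have : (e%:E <= limn (fun N => (\int[mu]_x ((cmod (S N x - F x)) ^+ 2)%:E)))%E.
    apply: lime_ge => //; apply: nearW => N; apply: ltW.
    by have /negP := h N; rewrite -ltNge.
  by rewrite (cvg_lim _ cv)// lee_fin leNgt e0.
have LF : L2 mu F.
  split => //; have [N hN] := small 1 ltr01.
  apply: le_lt_trans (young 1 N ltr01) _.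
  apply: le_lt_trans (leeD2l _ (lee_wpmul2l _ hN)) _; first by rewrite lee_fin addr_ge0// invr_ge0.
  by rewrite -EFinM -EFinD ltry.
split => //; have [sr si] := L2_sqi LF.
have b0 : 0 <= b by apply: le_trans (Sb 0); exact: nsq_ge0.
apply/ler_addgt0Pr => eta eta0.
(* With an error of at most [e ^+ 2], the excess over [b] is [e * b + e ^+ 2 + e], at most
   [e * (b + 2)] because [e <= 1], hence at most [eta]. *)
pose e := Num.min 1 (eta / (b + 2)).
have b2 : 0 < b + 2 by lra.
have e0 : 0 < e by rewrite lt_min ltr01 divr_gt0.
have e1 : e <= 1 by rewrite ge_min lexx.
have eb : e * (b + 2) <= eta by rewrite -ler_pdivlMr// ge_min lexx orbT.
have [N hN] := small (e ^+ 2) (exprn_gt0 _ e0).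
rewrite -lee_fin -nsqE//; apply: le_trans (young e N e0) _.
apply: le_trans (leeD2l _ (lee_wpmul2l _ hN)) _.
  by rewrite lee_fin addr_ge0// invr_ge0 ltW.
rewrite -EFinM -EFinD lee_fin [X in _ + X](_ : _ = e ^+ 2 + e); last first.
  by field; rewrite gt_eqF.
nra.
Qed.

Lemma ip_le_young (t : R) (u p : X -> R) : sqi mu u -> sqi mu p ->
  2 * t * ip mu u p <= t ^+ 2 * ip mu u u + ip mu p p.
Proof.
move=> su sp; have stu := sqiZ t su.
have := ip_ge0 mu (fun x => t * u x - p x).
rewrite ipBl//; last exact: sqiB.
rewrite !ipBr// !ipZl// !ipZr// (ipC _ p u); nra.
Qed.

(** Cauchy-Schwarz. With [z] the inner product, expanding the squared norm of [t * u - z * v] for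
    real [t] yields the quadratic inequality [key], in which [Z] is the squared modulus of [z]. *)
Lemma inner_sqr u v : L2 mu u -> L2 mu v ->
  cmod (inner mu u v) ^+ 2 <= nsq u * nsq v.
Proof.
move=> /L2_sqi[ur ui] /L2_sqi[vr vi].
pose a := ip mu (re u) (re v) + ip mu (im u) (im v).
pose b := ip mu (im u) (re v) - ip mu (re u) (im v).
have Ea : cRe (inner mu u v) = a.
  rewrite /a /ip -RintegralD//; [|exact: sqi_mul..].
  by apply: eq_Rintegral => x _; rewrite cReM /=; ring.
have Eb : cIm (inner mu u v) = b.
  rewrite /b /ip -RintegralB//; [|exact: sqi_mul..].
  by apply: eq_Rintegral => x _; rewrite cImM /=; ring.
rewrite cmod2 Ea Eb; set Z := a ^+ 2 + b ^+ 2.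
have avr := sqiZ a vr; have bvi := sqiZ b vi.
have avi := sqiZ a vi; have bvr := sqiZ b vr.
have sp : sqi mu (fun x => a * cRe (v x) - b * cIm (v x)) by exact: sqiB.
have sq : sqi mu (fun x => a * cIm (v x) + b * cRe (v x)) by exact: sqiD.
have EZ : Z = ip mu (re u) (fun x => a * cRe (v x) - b * cIm (v x)) +
              ip mu (im u) (fun x => a * cIm (v x) + b * cRe (v x)).
  by rewrite ipBr// ipDr// !ipZr// /Z !expr2 {2}/a {2}/b; ring.
have EV : ip mu (fun x => a * cRe (v x) - b * cIm (v x)) (fun x => a * cRe (v x) - b * cIm (v x)) +
  ip mu (fun x => a * cIm (v x) + b * cRe (v x)) (fun x => a * cIm (v x) + b * cRe (v x)) =
  Z * nsq v.
  rewrite (ipBl avr bvi sp) (ipBr avr bvi avr) (ipBr avr bvi bvi) (ip_sqrD avi bvr).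
  rewrite !ipZl// !ipZr// (ipC mu (im v) (re v)) /Z /nsq; ring.
have key t : 2 * t * Z <= t ^+ 2 * nsq u + Z * nsq v.
  rewrite {1}EZ -EV /nsq.
  have := ip_le_young t ur sp; have := ip_le_young t ui sq; lra.
have Z0 : 0 <= Z by rewrite addr_ge0 ?sqr_ge0.
have := nsq_ge0 u; have := nsq_ge0 v; set U := nsq u in key *; set V := nsq v in key *.
(* For [V > 0] the choice [t = V] is conclusive. For [V = 0] the choice [Z / (U + 1)], whose
   denominator is never zero, forces [Z = 0]. *)
rewrite le_eqVlt => /orP[/eqP V0|V0] U0.
  have := key (Z / (U + 1)); rewrite -V0 !mulr0 addr0.
  have U1 : 0 < U + 1 by lra.
  have -> : (Z / (U + 1)) ^+ 2 * U = Z ^+ 2 * U / (U + 1) / (U + 1).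
    by field; rewrite gt_eqF.
  have -> : 2 * (Z / (U + 1)) * Z = 2 * Z ^+ 2 / (U + 1).
    by field; rewrite gt_eqF.
  rewrite ler_pM2r ?invr_gt0// ler_pdivlMr// => h; nra.
have := key V; rewrite -(ler_pM2r V0 Z); nra.
Qed.

Lemma inner_le u v : L2 mu u -> L2 mu v ->
  cmod (inner mu u v) <= norm2 mu u * norm2 mu v.
Proof.
move=> Lu Lv.
rewrite -(@ler_pXn2r _ 2) ?nnegrE ?mulr_ge0 ?cmod_ge0 ?norm2_ge0//.
by rewrite exprMn !norm2_sqr//; exact: inner_sqr.
Qed.

End ComplexL2.

(** * Norms of the good and bad parts *)

Section GoodBad.
Set Implicit Arguments.
Unset Strict Implicit.
Context {R : realType} {d : nat}.
Local Notation X := (d.-tuple R).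
Variables (mu : probability X R) (H : set X) (c : 'I_d -> R).
Implicit Types (f u v : X -> R[i]) (w : X) (k : nat) (j : 'I_d -> nat).
Local Notation re u := (fun x => cRe (u x)).
Local Notation im u := (fun x => cIm (u x)).
Local Notation ordfun j := (fun i => nat_of_ord (j i)).

Lemma cRe_if (b : bool) (z z' : R[i]) : cRe (if b then z else z') = if b then cRe z else cRe z'.
Proof. by case: b. Qed.
Lemma cIm_if (b : bool) (z z' : R[i]) : cIm (if b then z else z') = if b then cIm z else cIm z'.
Proof. by case: b. Qed.

Lemma cRe_avg (A : set X) f : cRe (avg mu A f) = ravg mu A (re f).
Proof. by rewrite /avg cReM /= mul0r subr0. Qed.
Lemma cIm_avg (A : set X) f : cIm (avg mu A f) = ravg mu A (im f).
Proof. by rewrite /avg cImM /= mul0r addr0. Qed.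

Lemma cRe_Delta w k j f x : cRe (Delta mu H c w k j f x) = rDelta mu H c w k j (re f) x.
Proof.
rewrite /Delta cRe_sum; apply: eq_bigr => e _.
by rewrite !cRe_if !cReB !cRe_avg.
Qed.
Lemma cIm_Delta w k j f x : cIm (Delta mu H c w k j f x) = rDelta mu H c w k j (im f) x.
Proof.
rewrite /Delta cIm_sum; apply: eq_bigr => e _.
by rewrite !cIm_if !cImB !cIm_avg.
Qed.

Lemma cRe_psum sel w N f x :
  cRe (psum mu H c sel w N f x) = rpsum mu H c w (re f) sel 0 N.+1 x.
Proof.
rewrite /rpsum add0r cRe_sum; apply: eq_bigr => k _; rewrite cRe_sum.
by apply: eq_bigr => j _; rewrite cRe_if cRe_Delta.
Qed.
Lemma cIm_psum sel w N f x :
  cIm (psum mu H c sel w N f x) = rpsum mu H c w (im f) sel 0 N.+1 x.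
Proof.
rewrite /rpsum add0r cIm_sum; apply: eq_bigr => k _; rewrite cIm_sum.
by apply: eq_bigr => j _; rewrite cIm_if cIm_Delta.
Qed.

(** The squared norm of the difference on a transit cube. The value zero on terminal cubes leaves
    badness as the only selection in the sums below. *)
Definition energy f w k j : R :=
  if `[< transit mu H c w k j >] then
    ip mu (rDelta mu H c w k j (re f)) (rDelta mu H c w k j (re f)) +
    ip mu (rDelta mu H c w k j (im f)) (rDelta mu H c w k j (im f))
  else 0.

Lemma energy_ge0 f w k j : 0 <= energy f w k j.
Proof. by rewrite /energy; case: ifP => // _; rewrite addr_ge0 ?ip_ge0. Qed.

Lemma bessel_energy f w n : L2 mu f ->
  (\int[mu]_x cRe (f x)) ^+ 2 + (\int[mu]_x cIm (f x)) ^+ 2 +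
  \sum_(k < n) \sum_(j : {ffun 'I_d -> 'I_(2 ^ k)%N}) energy f w k (ordfun j) <= nsq mu f.
Proof.
move=> /L2_sqi[sr si].
apply: le_trans (lerD (bessel H c w n sr) (bessel H c w n si)).
rewrite [leRHS]addrACA lerD2l le_eqVlt; apply/orP; left; apply/eqP.
rewrite -big_split; apply: eq_bigr => k _; rewrite -big_split; apply: eq_bigr => j _.
by rewrite /energy /=; case: ifP => // _; rewrite addr0.
Qed.

Lemma energy_sum f w n : L2 mu f ->
  \sum_(k < n) \sum_(j : {ffun 'I_d -> 'I_(2 ^ k)%N}) energy f w k (ordfun j) <= nsq mu f.
Proof.
move=> /(bessel_energy w n); apply: le_trans.
by rewrite lerDr addr_ge0 ?sqr_ge0.
Qed.

Section Selection.
Variables (f : X -> R[i]) (w : X) (sel : nat -> ('I_d -> nat) -> Prop).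
Hypothesis Lf : L2 mu f.

Lemma sel_energyE (n : nat) a b :
  ip mu (rpsum mu H c w (re f) sel a n) (rpsum mu H c w (re f) sel a n) +
  ip mu (rpsum mu H c w (im f) sel b n) (rpsum mu H c w (im f) sel b n) =
  a ^+ 2 + b ^+ 2 +
  \sum_(k < n) \sum_(j : {ffun 'I_d -> 'I_(2 ^ k)%N})
    (if `[< sel k (ordfun j) >] then energy f w k (ordfun j) else 0).
Proof.
have [sr si] := L2_sqi Lf.
rewrite !ip_rpsum2// addrACA; congr (_ + _).
rewrite -big_split; apply: eq_bigr => k _; rewrite -big_split; apply: eq_bigr => j _.
rewrite /energy /= asbool_and; case: `[< transit _ _ _ _ _ _ >]; case: `[< _ >] => //=;
  by rewrite ?addr0.
Qed.

Lemma L2_psum N : L2 mu (psum mu H c sel w N f) /\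
  nsq mu (psum mu H c sel w N f) =
  \sum_(k < N.+1) \sum_(j : {ffun 'I_d -> 'I_(2 ^ k)%N})
    (if `[< sel k (ordfun j) >] then energy f w k (ordfun j) else 0).
Proof.
have [sr si] := L2_sqi Lf.
have Er : re (psum mu H c sel w N f) = rpsum mu H c w (re f) sel 0 N.+1.
  by apply/funext => x; rewrite cRe_psum.
have Ei : im (psum mu H c sel w N f) = rpsum mu H c w (im f) sel 0 N.+1.
  by apply/funext => x; rewrite cIm_psum.
split; first by apply: sqi_L2; rewrite ?Er ?Ei; exact: sqi_rpsum.
by rewrite /nsq Er Ei sel_energyE !expr0n !add0r.
Qed.

(** By Pythagoras the squared norm is that of the mean plus the selected energies; adding the
    unselected ones gives the quantity in Bessel's inequality. *)
Lemma L2_Lam_psum N : L2 mu (fun x => Lam mu f x + psum mu H c sel w N f x) /\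
  nsq mu (fun x => Lam mu f x + psum mu H c sel w N f x) <= nsq mu f.
Proof.
have [sr si] := L2_sqi Lf.
set F := fun x => _.
have Er : re F = rpsum mu H c w (re f) sel (\int[mu]_x cRe (f x)) N.+1.
  by apply/funext => x; rewrite /F cReD cRe_psum /rpsum add0r.
have Ei : im F = rpsum mu H c w (im f) sel (\int[mu]_x cIm (f x)) N.+1.
  by apply/funext => x; rewrite /F cImD cIm_psum /rpsum add0r.
split; first by apply: sqi_L2; rewrite ?Er ?Ei; exact: sqi_rpsum.
rewrite {1}/nsq Er Ei sel_energyE.
apply: le_trans (bessel_energy w N.+1 Lf).
rewrite lerD2l; apply: ler_sum => k _; apply: ler_sum => j _ /=.
by case: ifP => // _; exact: energy_ge0.
Qed.

End Selection.

Lemma Sbad_bound tau m r w w' f F (b : R) : L2 mu f ->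
  L2lim mu (fun N => Sbad mu H c tau m r w w' N f) F ->
  (forall n, \sum_(k < n) \sum_(j : {ffun 'I_d -> 'I_(2 ^ k)%N})
    (if `[< bad c tau m r w k (ordfun j) w' >] then energy f w k (ordfun j) else 0) <= b) ->
  L2 mu F /\ nsq mu F <= b.
Proof.
move=> Lf lim hb; apply: (L2lim_bound lim) => N.
  by have [] := L2_psum w (fun k j => bad c tau m r w k j w') Lf N.
by have [_ ->] := L2_psum w (fun k j => bad c tau m r w k j w') Lf N.
Qed.

Lemma Sgood_bound tau m r w w' f F : L2 mu f ->
  L2lim mu (fun N => Sgood mu H c tau m r w w' N f) F ->
  L2 mu F /\ nsq mu F <= nsq mu f.
Proof.
move=> Lf lim; apply: (L2lim_bound lim) => N.
  by have [] := L2_Lam_psum w (fun k j => ~ bad c tau m r w k j w') Lf N.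
by have [_] := L2_Lam_psum w (fun k j => ~ bad c tau m r w k j w') Lf N.
Qed.

End GoodBad.

(** * Integral operators with bounded kernel *)

Section BoundedKernel.
Set Implicit Arguments.
Unset Strict Implicit.
Context {R : realType} {d : nat}.
Local Notation X := (d.-tuple R).
Variables (mu : probability X R) (K : X -> X -> R[i]).
Hypothesis bK : bounded_kernel K.
Implicit Types (u : X -> R[i]).
Local Notation re u := (fun x => cRe (u x)).
Local Notation im u := (fun x => cIm (u x)).

(** Tonelli applies to the positive and negative parts separately, so no integrability of [h] has to
    be assumed. *)
Lemma measurable_Rintegral2 {disp : measure_display} {T : measurableType disp} (h : T * X -> R) :
  measurable_fun setT h -> measurable_fun setT (fun x => Rintegral mu setT (fun y => h (x, y))).
Proof.
move=> mh.
have meh : measurable_fun setT (EFin \o h) by apply/measurable_EFinP.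
have mp := measurable_fun_fubini_tonelli_F (m2 := mu) _ (measurable_funepos meh) (fun=> funepos_ge0 _ _).
have mn := measurable_fun_fubini_tonelli_F (m2 := mu) _ (measurable_funeneg meh) (fun=> funeneg_ge0 _ _).
have mI : measurable_fun setT (fun x => \int[mu]_y (h (x, y))%:E)%E.
  apply: eq_measurable_fun (emeasurable_funB mp mn) => x _.
  by rewrite [RHS]integralE; congr (_ - _)%E; apply: eq_integral => y _; rewrite !(funeposE, funenegE).
exact: (measurableT_comp (@fine_measurable R setT measurableT) mI).
Qed.

(** The variance is nonnegative, [mu] being a probability. *)
Lemma jensen_sqr (u : X -> R) : sqi mu u -> (Rintegral mu setT u) ^+ 2 <= ip mu u u.
Proof.
move=> su; have := ip_ge0 mu (fun x => u x - Rintegral mu setT u).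
have sa := sqi_cst mu (Rintegral mu setT u).
have -> : (fun x => u x - Rintegral mu setT u) = (fun x => u x - cst (Rintegral mu setT u) x) by [].
rewrite (ipBl su sa (sqiB su sa)) (ipBr su sa su) (ipBr su sa sa) ip_cst.
have E : ip mu (cst (Rintegral mu setT u)) u = Rintegral mu setT u ^+ 2.
  by rewrite /ip RintegralZl ?expr2//; exact: sqi_int.
by rewrite (ipC mu u (cst _)) E; lra.
Qed.

Let mKf u (Lu : L2 mu u) :
  measurable_fun setT (fun p : X * X => cRe (K p.1 p.2 * u p.2)) /\
  measurable_fun setT (fun p : X * X => cIm (K p.1 p.2 * u p.2)).
Proof.
have [mr [mi _]] := bK; have [ur ui _] := Lu.
have ur2 : measurable_fun setT (fun p : X * X => cRe (u p.2)).
  exact: (measurableT_comp ur measurable_snd).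
have ui2 : measurable_fun setT (fun p : X * X => cIm (u p.2)).
  exact: (measurableT_comp ui measurable_snd).
split.
  rewrite (_ : (fun _ => _) = fun p : X * X => cRe (K p.1 p.2) * cRe (u p.2) - cIm (K p.1 p.2) * cIm (u p.2)).
    by apply: measurable_funB; exact: measurable_funM.
  by apply/funext => p; rewrite cReM.
rewrite (_ : (fun _ => _) = fun p : X * X => cRe (K p.1 p.2) * cIm (u p.2) + cIm (K p.1 p.2) * cRe (u p.2)).
  by apply: measurable_funD; exact: measurable_funM.
by apply/funext => p; rewrite cImM.
Qed.

Let sKf u (Lu : L2 mu u) x : sqi mu (fun y => cRe (K x y * u y)) /\ sqi mu (fun y => cIm (K x y * u y)).
Proof.
have [m1 m2] := mKf Lu; have [_ [_ [C hC]]] := bK.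
have [ur ui um] := Lu.
have C0 : 0 <= C by apply: le_trans (hC x x); exact: cmod_ge0.
have [sr si] := L2_sqi Lu.
have sabs h : sqi mu h -> sqi mu (fun y => `|h y|).
  move=> sh; apply: (sqi_le _ sh); last by move=> y; rewrite normr_id.
  by apply: (measurableT_comp (@normr_measurable R setT)); case: sh.
have sdom : sqi mu (fun y => C * (`|cRe (u y)| + `|cIm (u y)|)).
  by apply: sqiZ; apply: sqiD; exact: sabs.
have le y : cmod (K x y * u y) <= `|C * (`|cRe (u y)| + `|cIm (u y)|)|.
  rewrite ger0_norm ?mulr_ge0 ?addr_ge0// cmodM ler_pM ?cmod_ge0//.
  rewrite -(@ler_pXn2r _ 2) ?nnegrE ?addr_ge0 ?cmod_ge0// cmod2 sqrrD.
  rewrite !real_normK ?num_real//.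
  have : 0 <= `|cRe (u y)| * `|cIm (u y)| by rewrite mulr_ge0.
  lra.
split; apply: (sqi_le _ sdom).
- exact: (measurableT_comp m1 (pair1_measurable x)).
- by move=> y; apply: le_trans (le y); exact: cRe_le_cmod.
- exact: (measurableT_comp m2 (pair1_measurable x)).
- by move=> y; apply: le_trans (le y); exact: cIm_le_cmod.
Qed.

(** For fixed [x], Jensen and the bound on the kernel give [C ^+ 2 * nsq mu u] for the squared
    modulus; integrating this constant over a probability changes nothing. The lemma makes the
    operator norm finite and keeps the image in L2. *)
Lemma intop_bound : exists2 C : R, 0 <= C &
  forall u, L2 mu u -> L2 mu (intop mu K u) /\ norm2 mu (intop mu K u) <= C * norm2 mu u.
Proof.
have [_ [_ [C hC]]] := bK.
have C0 : 0 <= C by apply: le_trans (hC [tuple of nseq d 0] [tuple of nseq d 0]); exact: cmod_ge0.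
exists C => // u Lu.
have [ur ui] := L2_sqi Lu.
have pt x : cmod (intop mu K u x) ^+ 2 <= C ^+ 2 * nsq mu u.
  have [s1 s2] := sKf Lu x.
  rewrite cmod2 /=; apply: (@le_trans _ _ (nsq mu (fun y => K x y * u y))).
    by apply: lerD; exact: jensen_sqr.
  rewrite -lee_fin -nsqE// EFinM -nsqE// -ge0_integralZl_EFin ?sqr_ge0//; last 2 first.
  - by move=> y _; rewrite lee_fin sqr_ge0.
  - by apply/measurable_EFinP; case: Lu => a b _; exact: (measurable_cmod2 a b).
  apply: ge0_le_integral => //.
  - by move=> y _; rewrite lee_fin sqr_ge0.
  - by apply/measurable_EFinP; exact: (measurable_cmod2 s1.1 s2.1).
  - by apply: measurable_funeM; apply/measurable_EFinP; case: Lu => a b _; exact: (measurable_cmod2 a b).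
  - by move=> y _; rewrite -EFinM lee_fin cmodM exprMn ler_wpM2r ?sqr_ge0// lerXn2r ?nnegrE ?cmod_ge0.
have [m1 m2] := mKf Lu.
have ptC x : cmod (intop mu K u x) <= C * norm2 mu u.
  rewrite -(@ler_pXn2r _ 2) ?nnegrE ?mulr_ge0 ?cmod_ge0 ?norm2_ge0//.
  by rewrite exprMn norm2_sqr.
have LT : L2 mu (intop mu K u).
  have sC := sqi_cst mu (C * norm2 mu u).
  have nC : `|C * norm2 mu u| = C * norm2 mu u by rewrite ger0_norm// mulr_ge0// norm2_ge0.
  apply: sqi_L2; apply: (sqi_le _ sC).
  - exact: (measurable_Rintegral2 m1).
  - by move=> x /=; rewrite nC; apply: le_trans (cRe_le_cmod _) (ptC x).
  - exact: (measurable_Rintegral2 m2).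
  - by move=> x /=; rewrite nC; apply: le_trans (cIm_le_cmod _) (ptC x).
split => //.
rewrite -(@ler_pXn2r _ 2) ?nnegrE ?mulr_ge0 ?norm2_ge0//.
rewrite exprMn !norm2_sqr// -lee_fin; have [tr ti] := L2_sqi LT; rewrite -nsqE//.
apply: (@le_trans _ _ (\int[mu]_x (cst (C ^+ 2 * nsq mu u)%:E x))%E).
  apply: ge0_le_integral => //.
  - by move=> y _; rewrite lee_fin sqr_ge0.
  - by apply/measurable_EFinP; exact: (measurable_cmod2 tr.1 ti.1).
  - by move=> x _; rewrite lee_fin.
by rewrite integral_cst// [X in (_ * X)%E]probability_setT mule1.
Qed.

Lemma intopZ (a : R) u : L2 mu u ->
  intop mu K (fun x => creal a * u x) = (fun x => creal a * intop mu K u x).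
Proof.
move=> Lu; apply/funext => x; have [s1 s2] := sKf Lu x.
rewrite /intop; set z' := cint mu setT (fun y => K x y * u y); set z := cint _ _ _.
have Er : cRe z = a * cRe z'.
  rewrite /z /z' /= -RintegralZl//; last exact: sqi_int.
  by apply: eq_Rintegral => y _; rewrite !(cReM, cImM) /=; ring.
have Ei : cIm z = a * cIm z'.
  rewrite /z /z' /= -RintegralZl//; last exact: sqi_int.
  by apply: eq_Rintegral => y _; rewrite !(cReM, cImM) /=; ring.
clearbody z z'; case: z z' Er Ei => [p q] [p' q'] /= -> ->.
by rewrite /creal; apply/eqP; rewrite eq_complex /= !mul0r subr0 addr0 !eqxx.
Qed.

Lemma norm2Z (a : R) u : L2 mu u -> L2 mu (fun x => creal a * u x) /\
  norm2 mu (fun x => creal a * u x) = `|a| * norm2 mu u.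
Proof.
move=> Lu; have [ur ui] := L2_sqi Lu.
have Er : re (fun x => creal a * u x) = (fun x => a * cRe (u x)).
  by apply/funext => x; rewrite cReM /= mul0r subr0.
have Ei : im (fun x => creal a * u x) = (fun x => a * cIm (u x)).
  by apply/funext => x; rewrite cImM /= mul0r addr0.
have La : L2 mu (fun x => creal a * u x) by apply: sqi_L2; rewrite ?Er ?Ei; exact: sqiZ.
split => //; rewrite !norm2E// -sqrtr_sqr -sqrtrM ?sqr_ge0//; congr Num.sqrt.
have sar := sqiZ a ur; have sai := sqiZ a ui.
by rewrite /nsq Er Ei !ipZl// !ipZr//; ring.
Qed.

(** The supremum over the unit ball is finite by [intop_bound], and homogeneity extends its bound to
    every square-integrable function. *)
Lemma opnorm_real : exists2 M : R, 0 <= M & opnorm mu K = M%:E /\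
  forall u, L2 mu u -> norm2 mu (intop mu K u) <= M * norm2 mu u.
Proof.
have [C C0 hC] := intop_bound.
have L0 : L2 mu (fun=> creal 0).
  by apply: sqi_L2; exact: (sqi_cst mu 0).
have n0 : norm2 mu (fun=> creal 0) = 0.
  by rewrite norm2E// /nsq (ip_cst mu 0 0) mulr0 addr0 sqrtr0.
have ub u : L2 mu u -> norm2 mu u <= 1 -> ((norm2 mu (intop mu K u))%:E <= opnorm mu K)%E.
  by move=> Lu u1; apply: ereal_sup_ubound; exists u.
have op0 : (0 <= opnorm mu K)%E.
  apply: le_trans (ub _ L0 _); first by rewrite lee_fin norm2_ge0.
  by rewrite n0.
have opC : (opnorm mu K <= C%:E)%E.
  apply: ge_ereal_sup => _ [u [Lu u1] <-]; rewrite lee_fin.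
  by have [_ h] := hC u Lu; apply: le_trans h _; rewrite ler_piMr.
have opf : opnorm mu K \is a fin_num.
  by rewrite ge0_fin_numE//; apply: le_lt_trans opC _; rewrite ltry.
exists (fine (opnorm mu K)); first exact: fine_ge0.
split; first by rewrite fineK.
move=> u Lu; apply/ler_addgt0Pr => e e0.
set M := fine _; have M0 : 0 <= M by exact: fine_ge0.
(* Normalising by a number slightly above the norm also covers norm zero; the price
   [M * (e / (M + 1))] is at most [e]. *)
pose t := norm2 mu u + e / (M + 1).
have M1 : 0 < M + 1 by lra.
have t0 : 0 < t by rewrite ltr_wpDl ?norm2_ge0// divr_gt0.
have [Lt nt] := norm2Z t^-1 Lu.
have ut : t^-1 * norm2 mu u <= 1.
  by rewrite ler_pdivrMl// mulr1 lerDl divr_ge0// ltW.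
have := ub _ Lt; rewrite nt gtr0_norm ?invr_gt0// intopZ// => /(_ ut).
have [LT _] := hC u Lu; have [_ ->] := norm2Z t^-1 LT.
rewrite gtr0_norm ?invr_gt0// -[X in (_ <= X)%E]fineK// lee_fin ler_pdivrMl// -/M => h.
apply: le_trans h _; rewrite /t mulrDl [in leLHS]mulrC lerD2l mulrAC ler_pdivrMr//.
by rewrite ler_pM2l// lerDl.
Qed.

End BoundedKernel.

(** * Expectation over the shifts *)

Section IteratedIntegral.
Set Implicit Arguments.
Unset Strict Implicit.
Context {R : realType}.

Lemma Omega_cons n (t : R) (x : n.-tuple R) :
  @Om1 R t -> Omega x -> Omega (cons_tuple t x).
Proof.
rewrite /Om1 /= in_itv /= => Ot Ox i; rewrite /Omega.
case: (unliftP ord0 i) => [j ->|->]; last by rewrite tnth0.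
by rewrite tnthS; exact: Ox.
Qed.

(* No measurability is needed: for a nonnegative integrand the integral is a
   supremum over the simple functions below it. *)
Lemma le_integral_nomeas {disp} {T : measurableType disp} (mu : {measure set T -> \bar R})
    (D : set T) (F G : T -> \bar R) :
  (forall x, D x -> (0 <= F x <= G x)%E) ->
  (\int[mu]_(x in D) F x <= \int[mu]_(x in D) G x)%E.
Proof.
move=> FG; rewrite !ge0_integralE; last 2 first.
- by move=> x /FG /andP[h1 h2]; exact: le_trans h2.
- by move=> x /FG /andP[].
apply: ereal_sup_le => _ [h hF <-]; exists h => // x.
apply: le_trans (hF x) _; rewrite !patchE; case: ifPn => //.
by rewrite inE => /FG /andP[].
Qed.

Lemma itint_ge0 n (F : n.-tuple R -> \bar R) :
  (forall w, Omega w -> (0 <= F w)%E) -> (0 <= itint F)%E.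
Proof.
elim: n F => [|n IH] F F0 /=; first by apply: F0 => -[].
apply: mule_ge0 => //; apply: integral_ge0 => t Ot.
by apply: IH => w Ow; apply: F0; exact: Omega_cons.
Qed.

Lemma le_itint n (F G : n.-tuple R -> \bar R) :
  (forall w, Omega w -> (0 <= F w <= G w)%E) -> (itint F <= itint G)%E.
Proof.
elim: n F G => [|n IH] F G FG /=.
  by have /andP[] : (0 <= F [tuple] <= G [tuple])%E by apply: FG => -[].
apply: lee_wpmul2l => //; apply: le_integral_nomeas => t Ot; apply/andP; split.
  by apply: itint_ge0 => w Ow; have /andP[] := FG _ (Omega_cons Ot Ow).
by apply: IH => w Ow; apply: FG; exact: Omega_cons.
Qed.

Lemma lt_Om1 : - (1 / 40) < 1 / 40 :> R.
Proof. lra. Qed.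

(** The factor 20 is the inverse of the length of the interval, so this is the uniform law; adding
    the missing endpoint does not change the integral. *)
Lemma uniform_Om1 : exists U : probability (measurableTypeR R) R,
  forall f : measurableTypeR R -> \bar R, measurable_fun setT f ->
    (forall t, (0 <= f t)%E) ->
    ((20%:R : R)%:E * \int[@lebesgue_measure R]_(t in @Om1 R) f t)%E = (\int[U]_t f t)%E.
Proof.
exists (uniform_prob lt_Om1) => f mf f0; rewrite integral_uniform//.
congr (_ * _)%E; first by congr EFin; field.
by rewrite -integral_itv_obnd_cbnd//; exact: measurable_funTS.
Qed.

(** On measurable nonnegative integrands the iterated integral is integration against a probability,
    which makes Tonelli available for the two shifts. The law is built by pushing the product of the
    uniform law and the previous one forward along [cons_tuple]. *)
Lemma itint_probability n : exists P : probability (n.-tuple R) R,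
  forall F : n.-tuple R -> \bar R, measurable_fun setT F ->
    (forall x, (0 <= F x)%E) -> itint F = (\int[P]_x F x)%E.
Proof.
elim: n => [|n [P hP]].
  exists (dirac ([tuple] : 0.-tuple R)) => F mF F0 /=.
  by rewrite integral_dirac// diracT mul1e.
have [U hU] := uniform_Om1.
have m1 : @measurable_fun _ _ (measurableTypeR R * n.-tuple R)%type R setT fst.
  exact: (@measurable_fst _ _ (measurableTypeR R) _).
have mc := measurable_cons m1 measurable_snd.
pose C : {mfun (measurableTypeR R * n.-tuple R)%type >-> n.+1.-tuple R} := HB.pack (fun p : measurableTypeR R * n.-tuple R => cons_tuple (p.1 : R) p.2)
  (isMeasurableFun.Build _ _ _ _ _ mc).
exists (distribution (U \x P)%E C) => F mF F0.
rewrite ge0_integral_distribution//.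
have mFC : measurable_fun setT (F \o C) by exact: measurableT_comp.
have mI := measurable_fun_fubini_tonelli_F (m2 := P) _ mFC (fun=> F0 _).
rewrite fubini_tonelli1//; last by move=> x; exact: F0.
transitivity ((20%:R : R)%:E * \int[@lebesgue_measure R]_(t in @Om1 R) fubini_F P (F \o C) t)%E.
  rewrite [LHS]/=; congr (_ * _)%E; apply: eq_integral => t _; rewrite hP//.
  exact: (measurableT_comp mFC (pair1_measurable t)).
by apply: hU => // t; apply: integral_ge0 => y _; exact: F0.
Qed.

End IteratedIntegral.

(** * Joint measurability in the shifts *)

Section OpenSets.
Set Implicit Arguments.
Unset Strict Implicit.
Import numFieldNormedType.Exports.
Context {R : realType} {d : nat}.
Local Notation X := (d.-tuple R).
Implicit Types (x y w : X) (A H : set X).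

Lemma measurable_openbox x (rho : R) : measurable (openbox x rho).
Proof.
apply: measurable_forall_ord => i; apply: measurable_set_bool.
apply: measurable_fun_ltr => //.
apply: (measurableT_comp (@normr_measurable R setT)).
by apply: measurable_funB => //; exact: measurable_tnth.
Qed.

(** An open set is the countable union of the boxes with rational centre and radius that it
    contains. *)
Lemma openRd_measurable A : openRd A -> measurable A.
Proof.
move=> oA.
pose box (q : d.-tuple rat * rat) := openbox ([tuple ratr (tnth q.1 i) | i < d] : X) (ratr q.2).
rewrite (_ : A = \bigcup_q (if `[< box q `<=` A >] then box q else set0)).
  apply: countable_bigcupT_measurable; first exact: countableP.
  by move=> q; case: ifP => // _; exact: measurable_openbox.
apply/seteqP; split => [x Ax|x [q _]]; last by case: asboolP => // qA /qA.
have [rho rho0 xA] := oA x Ax.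
(* A rational centre within [s < rho / 2] of [x] gives a box of radius [s] that contains [x] and
   stays within [rho] of it. *)
have [s] := @rat_in_itvoo R 0 (rho / 2) (divr_gt0 rho0 (ltr0Sn _ _)).
rewrite in_itv /= => /andP[s0 s2].
have ex i : exists q : rat, `|tnth x i - ratr q| < ratr s.
  have lt : tnth x i - ratr s < tnth x i + ratr s.
    by rewrite ltrBlDr -addrA ltrDl addr_gt0.
  have [q] := rat_in_itvoo lt.
  by rewrite in_itv /= => q1; exists q; rewrite ltr_distlC.
pose q : d.-tuple rat := [tuple projT1 (cid (ex i)) | i < d].
have hq i : `|tnth x i - ratr (tnth q i)| < ratr s.
  by rewrite tnth_mktuple; exact: (projT2 (cid (ex i))).
exists (q, s) => //; rewrite asboolT; first by move=> i; rewrite tnth_mktuple.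
move=> y yq; apply: xA => i.
have h1 : `|ratr (tnth q i) - tnth x i| < ratr s by rewrite distrC; exact: hq.
have h2 : `|tnth y i - ratr (tnth q i)| < ratr s by have := yq i; rewrite tnth_mktuple.
apply: le_lt_trans (ler_distD (ratr (tnth q i)) _ _) _; rewrite [ltRHS]splitr.
by apply: ltrD; [exact: lt_trans h2 s2|exact: lt_trans h1 s2].
Qed.

(** Compactness of the closed box, transported to row vectors and used in its near-covering form,
    makes the radius uniform. *)
Lemma lebesgue_number (a b : 'I_d -> R) H : openRd H ->
  (forall x, (forall i, a i <= tnth x i <= b i) -> H x) ->
  exists2 rho : R, 0 < rho & forall x, (forall i, a i <= tnth x i <= b i) ->
    openbox x rho `<=` H.
Proof.
move=> oH abH.
pose tup (v : 'rV[R]_d) : X := [tuple v ord0 i | i < d].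
have cK := @rV_compact R d (fun i => `[a i, b i]%classic) (fun i => @segment_compact R (a i) (b i)).
have : \forall rho \near (0 : R)^'+,
    [set v : 'rV[R]_d | forall i, `[a i, b i]%classic (v ord0 i)] `<=`
    (fun v => openbox (tup v) rho `<=` H).
  apply: (proj1 (compact_near_coveringP _) cK R (0 : R)^'+ (fun rho v => openbox (tup v) rho `<=` H)) => v Kv.
  have [rho rho0 vH] : exists2 rho : R, 0 < rho & openbox (tup v) rho `<=` H.
    by apply/oH/abH => i; have := Kv i; rewrite tnth_mktuple /= in_itv.
  have r2 : 0 < rho / 2 by lra.
  (* Halving leaves room for the triangle inequality: half of [rho] for moving the centre, half for
     the radius of the box. *)
  exists (ball v (rho / 2), [set e | e < rho / 2]) => /=.
    split; first exact: nbhsx_ballx.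
    exact: nbhs_right_lt.
  move=> [v' e] /= [[_ vv'] erho] y yv'; apply: vH => i.
  have := vv' ord0 i; have := yv' i; rewrite !tnth_mktuple /ball /= => h1.
  rewrite distrC => h2; rewrite (_ : _ - _ = (tnth y i - v' ord0 i) + (v' ord0 i - v ord0 i)); last by ring.
  by apply: le_lt_trans (ler_normD _ _) _; lra.
move=> near_rho.
have [rho [rho0 Hrho]] : exists rho : R, 0 < rho /\
    [set v : 'rV[R]_d | forall i, `[a i, b i]%classic (v ord0 i)] `<=`
    (fun v => openbox (tup v) rho `<=` H).
  near (0 : R)^'+ => rho; exists rho; split => //; near: rho => //.
exists rho => // x xab.
have -> : x = tup (\row_i tnth x i).
  by apply: eq_from_tnth => i; rewrite tnth_mktuple mxE.
by apply: Hrho => i /=; rewrite mxE in_itv /=.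
Unshelve. all: by end_near.
Qed.

Definition tsub x y : X := [tuple tnth x i - tnth y i | i < d].

Lemma measurable_tsub : measurable_fun setT (fun p : X * X => tsub p.1 p.2).
Proof.
apply/measurable_fun_tnthP => i.
rewrite (_ : _ \o _ = fun p : X * X => tnth p.1 i - tnth p.2 i); last first.
  by apply/funext => p; rewrite /= tnth_mktuple.
by apply: measurable_funB; exact: (measurableT_comp (measurable_tnth i)).
Qed.

Lemma sqr_dist_perturb (a : 'I_d -> R) (r : R) : \sum_(i < d) a i ^+ 2 < r ->
  exists2 eta : R, 0 < eta & forall h : 'I_d -> R, (forall i, `|h i| < eta) ->
    \sum_(i < d) (a i + h i) ^+ 2 < r.
Proof.
move=> ar; pose B := \sum_(i < d) (2 * `|a i| + 1).
have B0 : 0 <= B by apply: sumr_ge0 => i _; rewrite addr_ge0// mulr_ge0.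
have B1 : 0 < B + 1 by lra.
(* Since [eta <= 1], the sum grows by at most [B * eta]; dividing the gap by [B + 1] rather than [B]
   keeps the inequality strict. *)
exists (Num.min 1 ((r - \sum_(i < d) a i ^+ 2) / (B + 1))).
  by rewrite lt_min ltr01 divr_gt0// subr_gt0.
move=> h hh; set eta := Num.min _ _ in hh.
have e0 : 0 <= eta by rewrite le_min ler01 divr_ge0// ltW// subr_gt0.
have e1 : eta <= 1 by rewrite ge_min lexx.
have : \sum_(i < d) (a i + h i) ^+ 2 <= \sum_(i < d) (a i ^+ 2 + (2 * `|a i| + 1) * eta).
  apply: ler_sum => i _; have hi := ltW (hh i).
  have h2 : h i ^+ 2 <= eta.
    rewrite -real_normK ?num_real// expr2; apply: le_trans (ler_pM _ _ hi (le_trans hi e1)) _ => //.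
    by rewrite mulr1.
  have h3 : a i * h i <= `|a i| * eta.
    by apply: le_trans (ler_norm _) _; rewrite normrM ler_wpM2l.
  by move: h2 h3; rewrite !expr2; lra.
rewrite big_split /= -mulr_suml -/B => le1; apply: le_lt_trans le1 _.
have : eta * (B + 1) <= r - \sum_(i < d) a i ^+ 2.
  by rewrite -ler_pdivlMr// ge_min lexx orbT.
have [e0'|e0'] := eqVneq eta 0; first by rewrite e0' mulr0 addr0.
have : 0 < eta by rewrite lt_neqAle eq_sym e0' e0.
lra.
Qed.

End OpenSets.

(** * Badness as a measurable condition on the pair of shifts *)

Section BadMeasurable.
Set Implicit Arguments.
Unset Strict Implicit.
Context {R : realType} {d : nat}.
Local Notation X := (d.-tuple R).
Variables (c : 'I_d -> R).
Implicit Types (w : X) (k : nat) (j : 'I_d -> nat).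

Definition close_to_skel k j k' j' (rho : R) : set (X * X) := [set p |
  exists x y, dQ c p.1 k j x /\ skel (dcorner c p.2 k' j') (dside R k') y /\ eucl x y < rho].

(** Each witness moves along with its own lattice, so their difference changes only through the
    difference of the shifts, and a strict distance inequality survives small changes. *)
Lemma close_to_skel_diff k j k' j' (rho : R) w w' : close_to_skel k j k' j' rho (w, w') ->
  exists2 eta : R, 0 < eta & forall v v',
    (forall i, `|(tnth v i - tnth v' i) - (tnth w i - tnth w' i)| < eta) ->
    close_to_skel k j k' j' rho (v, v').
Proof.
move=> [x [y [Qx [[e [sy1 sy2]] xy]]]].
have rho0 : 0 < rho by apply: le_lt_trans xy; exact: sqrtr_ge0.
have : \sum_(i < d) (tnth x i - tnth y i) ^+ 2 < rho ^+ 2.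
  have S0 : 0 <= \sum_(i < d) (tnth x i - tnth y i) ^+ 2 by apply: sumr_ge0 => i _; exact: sqr_ge0.
  by rewrite -(sqr_sqrtr S0) ltrXn2r//= ?sqrtr_ge0// ltW.
move=> /sqr_dist_perturb[eta eta0 heta]; exists eta => // v v' vw.
exists [tuple tnth x i + tnth v i - tnth w i | i < d].
exists [tuple tnth y i + tnth v' i - tnth w' i | i < d].
split; last split.
- move=> i; have := Qx i; rewrite tnth_mktuple /dcorner /= => /andP[h1 h2].
  by apply/andP; split; lra.
- exists e; split.
    move=> i; have := sy1 i; rewrite tnth_mktuple /dcorner /= => /andP[h1 h2].
    by apply/andP; split; lra.
  have [i si] := sy2; exists i; rewrite tnth_mktuple /dcorner /=.
  by move: si; rewrite /dcorner /= => -[] ->; [left|right]; ring.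
- rewrite /eucl -[ltRHS](@ger0_norm _ rho) ?ltW// -sqrtr_sqr ltr_sqrt ?exprn_gt0//.
  have := heta _ vw; congr (_ < _); apply: eq_bigr => i _.
  by rewrite !tnth_mktuple; congr (_ ^+ 2); ring.
Qed.

(** The set is the preimage of an open set of differences under the measurable map [tsub]. *)
Lemma measurable_close_to_skel k j k' j' rho : measurable (close_to_skel k j k' j' rho).
Proof.
pose O : set X := [set u | exists p, close_to_skel k j k' j' rho p /\ u = tsub p.1 p.2].
rewrite (_ : close_to_skel k j k' j' rho = (fun p : X * X => tsub p.1 p.2) @^-1` O).
  rewrite -[X in measurable X]setTI; apply: measurable_tsub => //.
  apply: openRd_measurable => _ [[w w'] [N ->]].
  have [eta eta0 h] := close_to_skel_diff N; exists eta => // u uw.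
  (* Any nearby difference is realised by keeping the second shift and moving only the first. *)
  have ue i : tnth u i = tnth ([tuple tnth u i + tnth w' i | i < d] : X) i - tnth w' i.
    by rewrite tnth_mktuple addrK.
  exists ([tuple tnth u i + tnth w' i | i < d], w'); split; last first.
    by apply: eq_from_tnth => i; rewrite tnth_mktuple -ue.
  by apply: h => i; rewrite -ue; have := uw i; rewrite tnth_mktuple.
apply/seteqP; split => [[w w'] N|[v v'] [[w w'] [N /= vw]]]; first by exists (w, w').
have [eta eta0 h] := close_to_skel_diff N; apply: h => i.
have := congr1 (fun t => tnth t i) vw; rewrite !tnth_mktuple => ->.
by rewrite subrr normr0.
Qed.

Lemma measurable_bad tau m r k j :
  measurable [set p : X * X | bad c tau m r p.1 k j p.2].
Proof.
pose rho k' : R := powR (dside R k) (alpha tau m) * powR (dside R k') (1 - alpha tau m).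
rewrite (_ : [set p | _] = \bigcup_k' \bigcup_(j' in [set: {ffun 'I_d -> 'I_(2 ^ k')%N}])
  (if powR 2 r%:~R * dside R k <= dside R k' then
     close_to_skel k j k' (fun i => nat_of_ord (j' i)) (rho k') else set0)).
  apply: bigcupT_measurable => k'; apply: countable_bigcupT_measurable; first exact: countableP.
  by move=> j'; case: ifP => // _; exact: measurable_close_to_skel.
apply/seteqP; split => [[w w'] [k' [j' [vj [le [x [y h]]]]]]|[w w'] [k' _ [j' _]]].
  exists k' => //; exists [ffun i => Ordinal (vj i)] => //; rewrite le.
  rewrite (_ : (fun i => _) = j'); first by exists x, y.
  by apply/funext => i; rewrite ffunE.
case: ifP => // le [x [y h]]; exists k', (fun i => nat_of_ord (j' i)).
by split; [move=> i; exact: ltn_ord|split => //; exists x, y].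
Qed.

End BadMeasurable.

(** * Measurability of the energies in the shift *)

Section EnergyMeasurable.
Set Implicit Arguments.
Unset Strict Implicit.
Context {R : realType} {d : nat}.
Local Notation X := (d.-tuple R).
Variables (mu : probability X R) (H : set X) (c : 'I_d -> R).
Hypothesis oH : openRd H.
Implicit Types (w : X) (k : nat) (j : 'I_d -> nat).

Lemma measurable_asbool {disp} {T : measurableType disp} (P : T -> Prop) :
  measurable [set t | P t] -> measurable_fun setT (fun t => `[< P t >]).
Proof.
move=> mP; apply: (measurable_fun_bool true); rewrite setTI.
by rewrite (_ : _ @^-1` _ = [set t | P t])//; apply/seteqP; split => t /asboolP.
Qed.

Lemma measurable_dQ_pair k j : measurable [set p : X * X | dQ c p.1 k j p.2].
Proof.
apply: (@measurable_cubeS _ _ _ d (fun i (p : X * X) => dcorner c p.1 k j i) (dside R k) snd) => //.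
move=> i; apply: measurable_funD => //; apply: measurable_funD => //.
exact: (measurableT_comp (measurable_tnth i) measurable_fst).
Qed.

Lemma measurable_mu_dQ k j : measurable_fun setT (fun w => mu (dQ c w k j)).
Proof.
have := measurable_fun_xsection mu (measurable_dQ_pair k j).
apply: eq_measurable_fun => w _ /=; congr (mu _).
by apply/seteqP; split => x; rewrite /xsection /= inE.
Qed.

(* A half-open box is the increasing union of closed boxes; for a closed box
   the set of shifts keeping it inside [H] is open, by compactness. *)
Lemma measurable_doubleS_sub k j :
  measurable [set w : X | Defs.doubleS (dcorner c w k j) (dside R k) `<=` H].
Proof.
pose l := dside R k.
pose lo w i := dcorner c w k j i - l / 2.
pose V n := [set w : X | forall x, (forall i, lo w i <= tnth x i <= lo w i + 2 * l - n.+1%:R^-1) -> H x].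
rewrite (_ : [set w | _] = \bigcap_n V n); last first.
  apply/seteqP; split => [w wH n _ x hx|w wV x hx].
    apply: wH => i; have /andP[h1 h2] := hx i; rewrite -/(lo w i) h1 /=.
    by apply: le_lt_trans h2 _; rewrite ltrBlDr ltrDl invr_gt0.
  have [n hn] : exists n, forall i, tnth x i <= lo w i + 2 * l - n.+1%:R^-1.
    have ex i : exists n, tnth x i <= lo w i + 2 * l - n.+1%:R^-1.
      have /andP[_ h2] := hx i.
      pose e := lo w i + 2 * l - tnth x i.
      have e0 : 0 < e by rewrite subr_gt0.
      (* The gap [e] below the open face exceeds the inverse of [n + 1] for [n] the integer part of
         the inverse of [e]. *)
      exists (Num.truncn e^-1); rewrite lerBrDr -lerBrDl -/e.
      rewrite -[leRHS]invrK lef_pV2 ?posrE ?invr_gt0//; apply: ltW; exact: truncnS_gt.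
    pose N := \max_(i < d) projT1 (cid (ex i)).
    exists N => i; apply: le_trans (projT2 (cid (ex i))) _.
    rewrite lerD2l lerN2 lef_pV2 ?posrE// ler_nat ltnS.
    exact: (leq_bigmax i).
  by apply: (wV n) => // i; rewrite hn andbT; have /andP[] := hx i.
apply: bigcapT_measurable => n; apply: openRd_measurable => w Vw.
have [rho rho0 h] := lebesgue_number oH Vw.
exists rho => // w' ww' x hx.
(* Translating [x] back by the change of shift lands in the closed box for [w], and the translation
   is shorter than [rho] in each coordinate. *)
apply: (h [tuple tnth x i - (tnth w' i - tnth w i) | i < d]).
  move=> i; have := hx i; rewrite tnth_mktuple /lo /dcorner /= => /andP[h1 h2].
  by move: (n.+1%:R^-1) h2 => q h2; apply/andP; split; lra.
by move=> i; rewrite tnth_mktuple opprB addrC subrK; exact: ww'.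
Qed.

Lemma measurable_transit k j : measurable [set w : X | transit mu H c w k j].
Proof.
apply: measurableC; apply: measurableU; first exact: measurable_doubleS_sub.
by have := measurable_mu_dQ k j measurableT (emeasurable_set1 0); rewrite setTI.
Qed.

Lemma measurable_ravg k j (u : X -> R) : measurable_fun setT u ->
  measurable_fun setT (fun w => ravg mu (dQ c w k j) u).
Proof.
move=> mu_; apply: measurable_funM.
  (* The inverse of a nonnegative number is written as its power [-1], whose measurability is at
     hand. *)
  apply: eq_measurable_fun (measurableT_comp (@measurable_powR R (-1))
    (measurableT_comp (@fine_measurable R setT measurableT) (measurable_mu_dQ k j))) => w _ /=.
  by rewrite powR_inv1// fine_ge0.
have m2 : measurable_fun setT (fun p : X * X => \1_[set p : X * X | dQ c p.1 k j p.2] p * u p.2).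
  apply: measurable_funM; first by apply: measurable_indic; exact: measurable_dQ_pair.
  exact: (measurableT_comp mu_ measurable_snd).
apply: eq_measurable_fun (measurable_Rintegral2 mu m2) => w _ /=.
rewrite -[RHS]ip_indic; apply: eq_Rintegral => x _; rewrite !indicE; congr (_%:R * _).
Qed.

Lemma measurable_rDelta k j (u : X -> R) : measurable_fun setT u ->
  measurable_fun setT (fun p : X * X => rDelta mu H c p.1 k j u p.2).
Proof.
move=> mu_; apply: measurable_sum => e.
have mr k' j' : measurable_fun setT (fun p : X * X => ravg mu (dQ c p.1 k' j') u).
  exact: (measurableT_comp (measurable_ravg k' j' mu_) measurable_fst).
apply: measurable_fun_ifT => //.
  by apply: measurable_asbool; exact: measurable_dQ_pair.
apply: measurable_fun_ifT.
- exact: (measurableT_comp (measurable_asbool (measurable_transit k.+1 (dchild j e))) measurable_fst).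
- exact: measurable_funB.
- by apply: measurable_funB => //; exact: (measurableT_comp mu_ measurable_snd).
Qed.

Lemma measurable_energy k j (f : X -> R[i]) : L2 mu f ->
  measurable_fun setT (fun w => energy mu H c f w k j).
Proof.
move=> [mr mi _]; apply: measurable_fun_ifT => //.
  exact: (measurable_asbool (measurable_transit k j)).
have m u : measurable_fun setT u ->
    measurable_fun setT (fun w => ip mu (rDelta mu H c w k j u) (rDelta mu H c w k j u)).
  move=> mu_; have mD := measurable_rDelta k j mu_.
  exact: (measurable_Rintegral2 mu (measurable_funM mD mD)).
by apply: measurable_funD; exact: m.
Qed.

End EnergyMeasurable.

(** * The mean energy of the bad part *)

Section BadEnergy.
Set Implicit Arguments.
Unset Strict Implicit.
Context {R : realType} {d : nat}.
Local Notation X := (d.-tuple R).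
Variables (mu : probability X R) (H : set X) (c : 'I_d -> R) (tau m : R) (r : int).
Hypothesis oH : openRd H.
Variable f : X -> R[i].
Hypothesis Lf : L2 mu f.
Local Notation ordfun j := (fun i => nat_of_ord (j i)).

Definition bad_energy_gen k (p : X * X) : R :=
  \sum_(j : {ffun 'I_d -> 'I_(2 ^ k)%N})
    (if `[< bad c tau m r p.1 k (ordfun j) p.2 >] then energy mu H c f p.1 k (ordfun j) else 0).

(* [||f_bad||^2] for the lattices shifted by [p.1] and [p.2]. *)
Definition bad_energy (p : X * X) : \bar R := (\sum_(k <oo) (bad_energy_gen k p)%:E)%E.

Lemma bad_energy_gen_ge0 k p : 0 <= bad_energy_gen k p.
Proof. by apply: sumr_ge0 => j _; case: ifP => // _; exact: energy_ge0. Qed.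

Lemma bad_energy_ge0 p : (0 <= bad_energy p)%E.
Proof. by apply: nneseries_ge0 => k _ _; rewrite lee_fin bad_energy_gen_ge0. Qed.

Lemma measurable_bad_term k (j : {ffun 'I_d -> 'I_(2 ^ k)%N}) : measurable_fun setT (fun p : X * X =>
  if `[< bad c tau m r p.1 k (ordfun j) p.2 >] then energy mu H c f p.1 k (ordfun j) else 0).
Proof.
apply: measurable_fun_ifT => //; first by apply: measurable_asbool; exact: measurable_bad.
have mE := @measurable_energy R d mu H c oH k (ordfun j) f Lf.
exact: (measurableT_comp mE measurable_fst).
Qed.

Lemma measurable_bad_energy : measurable_fun setT bad_energy.
Proof.
apply: (@ge0_emeasurable_sum _ _ _ setT (fun k p => (bad_energy_gen k p)%:E) predT) => k.
  by move=> p _ _; rewrite lee_fin bad_energy_gen_ge0.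
move=> _; apply/measurable_EFinP; apply: measurable_sum => j; exact: measurable_bad_term.
Qed.

(** Dropping the restriction to bad cubes only increases the sum, and Bessel bounds every partial
    sum. *)
Lemma bad_energy_le p : (bad_energy p <= (nsq mu f)%:E)%E.
Proof.
apply: lime_le; first by apply: is_cvg_nneseries => k _ _; rewrite lee_fin bad_energy_gen_ge0.
apply: nearW => n; rewrite sumEFin lee_fin big_mkord.
apply: le_trans (energy_sum H c p.1 n Lf); apply: ler_sum => k _; apply: ler_sum => j _.
by case: ifP => // _; exact: energy_ge0.
Qed.

Lemma partial_bad_energy_le p n :
  \sum_(k < n) bad_energy_gen k p <= fine (bad_energy p).
Proof.
have fin : bad_energy p \is a fin_num.
  by rewrite ge0_fin_numE ?bad_energy_ge0//; apply: le_lt_trans (bad_energy_le p) _; rewrite ltry.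
rewrite -lee_fin fineK// -sumEFin -(big_mkord xpredT (fun k => (bad_energy_gen k p)%:E)).
by apply: nneseries_lim_ge => k _ _; rewrite lee_fin bad_energy_gen_ge0.
Qed.

Lemma norm2_fbad w w' F : L2lim mu (fun N => Sbad mu H c tau m r w w' N f) F ->
  L2 mu F /\ nsq mu F <= fine (bad_energy (w, w')).
Proof.
by move=> lim; apply: (Sbad_bound Lf lim) => n; exact: (partial_bad_energy_le (w, w') n).
Qed.

Variable delta : R.
Hypothesis bad_prob : forall w k j, Omega w -> dvalid k j ->
  (itint (fun w' => if `[< bad c tau m r w k j w' >] then 1 else 0) <= (delta ^+ 2)%:E)%E.

Variable P : probability X R.
Hypothesis hP : forall F : X -> \bar R, measurable_fun setT F ->
  (forall x, (0 <= F x)%E) -> itint F = (\int[P]_x F x)%E.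

(** With [w] fixed the energies are constants and only badness is random. Each cube contributes its
    energy times a probability of at most [delta ^+ 2], and the energies sum to at most
    [nsq mu f]. *)
Lemma mean_bad_energy_shift w : Omega w ->
  (\int[P]_w' bad_energy (w, w') <= (delta ^+ 2 * nsq mu f)%:E)%E.
Proof.
move=> Ow; rewrite integral_nneseries//; last 2 first.
- move=> k; apply/measurable_EFinP; apply: measurable_sum => j.
  exact: (measurableT_comp (measurable_bad_term j) (pair1_measurable w)).
- by move=> k w' _; rewrite lee_fin bad_energy_gen_ge0.
apply: lime_le.
  by apply: is_cvg_nneseries => k _ _; apply: integral_ge0 => w' _; rewrite lee_fin bad_energy_gen_ge0.
apply: nearW => n.
have term k : (\int[P]_w' (bad_energy_gen k (w, w'))%:E <=
    (delta ^+ 2 * \sum_(j : {ffun 'I_d -> 'I_(2 ^ k)%N}) energy mu H c f w k (ordfun j))%:E)%E.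
  rewrite (eq_integral (fun w' => \sum_(j : {ffun 'I_d -> 'I_(2 ^ k)%N})
     (energy mu H c f w k (ordfun j))%:E * (if `[< bad c tau m r w k (ordfun j) w' >] then 1 else 0))%E); last first.
    move=> w' _; rewrite -sumEFin; apply: eq_bigr => j _ /=.
    by case: ifP => _; rewrite ?mule1 ?mule0.
  have mb j : measurable_fun setT (fun w' : X => if `[< bad c tau m r w k j w' >] then 1%E else 0%E : \bar R).
    apply: measurable_fun_ifT => //.
    have mbad := measurable_asbool (measurable_bad c tau m r k j).
    exact: (measurableT_comp mbad (pair1_measurable w)).
  have b0 j (w' : X) : (0 <= (if `[< bad c tau m r w k j w' >] then 1%E else 0%E : \bar R))%E.
    by case: ifP.
  rewrite ge0_integral_sum//; last 2 first.
  - by move=> j; apply: measurable_funeM; exact: mb.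
  - by move=> j w' _; apply: mule_ge0 => //; rewrite lee_fin energy_ge0.
  rewrite mulr_sumr -sumEFin; apply: lee_sum => j _.
  rewrite ge0_integralZl ?lee_fin ?energy_ge0//.
  rewrite mulrC EFinM; apply: lee_wpmul2l; first by rewrite lee_fin energy_ge0.
  by rewrite -hP//; apply: bad_prob => // i; exact: ltn_ord.
apply: le_trans (lee_sum _ (fun k _ => term k)) _.
rewrite sumEFin lee_fin -mulr_sumr ler_wpM2l ?sqr_ge0//.
by rewrite big_mkord; exact: energy_sum.
Qed.

Lemma mean_bad_energy :
  (\int[P]_w \int[P]_w' bad_energy (w, w') <= (delta ^+ 2 * nsq mu f)%:E)%E.
Proof.
have mI := measurable_fun_fubini_tonelli_F (m2 := P) _ measurable_bad_energy bad_energy_ge0.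
(* The inner bound holds for shifts in [Omega], so the outer integral is turned back into [itint],
   which sees only such shifts. *)
rewrite -hP//; last first.
  by move=> w; apply: integral_ge0 => w' _; exact: bad_energy_ge0.
apply: (@le_trans _ _ (itint (fun _ : X => (delta ^+ 2 * nsq mu f)%:E))).
  apply: le_itint => w Ow; rewrite mean_bad_energy_shift// andbT.
  by apply: integral_ge0 => w' _; exact: bad_energy_ge0.
rewrite hP//; last by move=> _; rewrite lee_fin mulr_ge0 ?sqr_ge0 ?nsq_ge0.
by rewrite integral_cst// [X in (_ * X)%E]probability_setT mule1.
Qed.

End BadEnergy.

(** * Averaging the remainder over both shifts *)

Section Expectation.
Set Implicit Arguments.
Unset Strict Implicit.
Context {R : realType} {d : nat}.
Local Notation X := (d.-tuple R).

(** [V] may fail to be measurable, so the comparison is made inside the iterated integral, level by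
    level; Tonelli is applied to the measurable majorant [F] alone. *)
Lemma le_itint2 (P : probability X R)
  (hP : forall F : X -> \bar R, measurable_fun setT F ->
    (forall x, (0 <= F x)%E) -> itint F = (\int[P]_x F x)%E)
  (V : X -> X -> \bar R) (F : X * X -> \bar R) :
  measurable_fun setT F -> (forall p, (0 <= F p)%E) ->
  (forall w1 w2, Omega w1 -> Omega w2 -> (0 <= V w1 w2 <= F (w1, w2))%E) ->
  (itint (fun w1 => itint (V w1)) <= \int[P \x P]_p F p)%E.
Proof.
move=> mF F0 VF.
have mI := measurable_fun_fubini_tonelli_F (m2 := P) _ mF F0.
rewrite fubini_tonelli1// -hP//; last by move=> w; apply: integral_ge0 => w' _; exact: F0.
apply: le_itint => w1 O1; apply/andP; split.
  by apply: itint_ge0 => w2 O2; have /andP[] := VF _ _ O1 O2.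
rewrite /fubini_F -hP//; last exact: (measurableT_comp mF (pair1_measurable w1)).
by apply: le_itint => w2 O2; exact: VF.
Qed.

(** The inequality of arithmetic and geometric means. It bounds a norm linearly in its square, so a
    bound on the mean energy suffices. *)
Lemma le_div2 (x s t : R) : 0 < s -> x ^+ 2 <= t -> x <= t / (2 * s) + s / 2.
Proof.
move=> s0 xt; have s2 : 0 < 2 * s by lra.
apply: (@le_trans _ _ (x ^+ 2 / (2 * s) + s / 2)); last by rewrite lerD2r ler_pM2r ?invr_gt0.
rewrite -subr_ge0 (_ : _ - _ = (x - s) ^+ 2 / (2 * s)).
  by rewrite divr_ge0 ?sqr_ge0// ltW.
by field; rewrite gt_eqF.
Qed.

End Expectation.

Theorem theorem17 (R : realType) (d : nat) (c : 'I_d -> R)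
  (mu : probability (d.-tuple R) R) (H : set (d.-tuple R))
  (tau m delta S : R) (r : int)
  (K : d.-tuple R -> d.-tuple R -> R[i]) (f g : d.-tuple R -> R[i])
  (fbad fgood gbad : d.-tuple R -> d.-tuple R -> d.-tuple R -> R[i]) :
  (0 < d)%N ->
  compact_supp_in_quarter mu c ->
  openRd H ->
  0 < tau <= 1 -> 0 < m -> 0 < delta -> 2 <= S ->
  powR 2 (- r%:~R) <= powR delta S < powR 2 (1 - r%:~R) ->
  (* every fixed cube of one lattice is bad with probability <= delta^2
     over the shift of the other lattice *)
  (forall w k j, Omega w -> dvalid k j ->
     (itint (fun w' => if `[< bad c tau m r w k j w' >] then 1 else 0)
        <= (delta ^+ 2)%:E)%E) ->
  bounded_kernel K ->
  L2 mu f -> L2 mu g ->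
  (* f_bad, f_good (w.r.t. D(w1), badness relative to D(w2)) and
     g_bad (w.r.t. D(w2), badness relative to D(w1)) *)
  (forall w1 w2, Omega w1 -> Omega w2 ->
     L2lim mu (fun N => Sbad mu H c tau m r w1 w2 N f) (fbad w1 w2)) ->
  (forall w1 w2, Omega w1 -> Omega w2 ->
     L2lim mu (fun N => Sgood mu H c tau m r w1 w2 N f) (fgood w1 w2)) ->
  (forall w1 w2, Omega w1 -> Omega w2 ->
     L2lim mu (fun N => Sbad mu H c tau m r w2 w1 N g) (gbad w1 w2)) ->
  (itint (fun w1 => itint (fun w2 =>
     (cmod (inner mu (intop mu K (fbad w1 w2)) g
            + inner mu (intop mu K (fgood w1 w2)) (gbad w1 w2)))%:E))
   <= (2 * delta)%:E * opnorm mu K * (norm2 mu f * norm2 mu g)%:E)%E.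
Proof.
move=> _ _ oH _ _ delta0 _ _ bad_prob bK Lf Lg hfbad hfgood hgbad.
have [P hP] := @itint_probability R d.
have [M M0 [-> hM]] := opnorm_real mu bK.
have [C _ hC] := intop_bound mu bK.
pose V w1 w2 := cmod (inner mu (intop mu K (fbad w1 w2)) g +
  inner mu (intop mu K (fgood w1 w2)) (gbad w1 w2)).
pose a := norm2 mu f; pose b := norm2 mu g; rewrite -/a -/b.
have a0 : 0 <= a by exact: norm2_ge0.
have b0 : 0 <= b by exact: norm2_ge0.
pose Ff := bad_energy mu H c tau m r f; pose Fg := bad_energy mu H c tau m r g.
have mFf : measurable_fun setT Ff by exact: measurable_bad_energy.
have mFg : measurable_fun setT Fg by exact: measurable_bad_energy.
have Ff0 p : (0 <= Ff p)%E by exact: bad_energy_ge0.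
have Fg0 p : (0 <= Fg p)%E by exact: bad_energy_ge0.
have fin h (Lh : L2 mu h) p : bad_energy mu H c tau m r h p \is a fin_num.
  rewrite ge0_fin_numE ?bad_energy_ge0//.
  by apply: le_lt_trans (bad_energy_le H c tau m r Lh p) _; rewrite ltry.
(* The pointwise estimate, with [x] and [y] the norms of the bad parts. The lattice of [g] is
   shifted by [w2], hence the exchanged arguments of [Fg]. *)
have bound w1 w2 : Omega w1 -> Omega w2 -> exists x y, [/\ 0 <= x <= a, 0 <= y <= b,
    x ^+ 2 <= fine (Ff (w1, w2)), y ^+ 2 <= fine (Fg (w2, w1)) &
    V w1 w2 <= M * (x * b + a * y)].
  move=> O1 O2.
  have [Lfb nfb] := norm2_fbad Lf (hfbad w1 w2 O1 O2).
  have [Lgb ngb] := norm2_fbad Lg (hgbad w1 w2 O1 O2).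
  have [Lfg nfg] := Sgood_bound Lf (hfgood w1 w2 O1 O2).
  have le_norm u v : L2 mu u -> L2 mu v -> nsq mu u <= nsq mu v -> norm2 mu u <= norm2 mu v.
    by move=> Lu Lv uv; rewrite !norm2E// ler_wsqrtr.
  have le_en h u p : L2 mu h -> nsq mu u <= fine (bad_energy mu H c tau m r h p) -> nsq mu u <= nsq mu h.
    move=> Lh le; apply: le_trans le _; rewrite -lee_fin fineK ?fin//.
    exact: bad_energy_le.
  exists (norm2 mu (fbad w1 w2)), (norm2 mu (gbad w1 w2)); split.
  - by rewrite norm2_ge0; apply: (le_norm _ _ Lfb Lf); exact: (le_en _ _ _ Lf nfb).
  - by rewrite norm2_ge0; apply: (le_norm _ _ Lgb Lg); exact: (le_en _ _ _ Lg ngb).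
  - by rewrite (norm2_sqr Lfb); exact: nfb.
  - by rewrite (norm2_sqr Lgb); exact: ngb.
  - have [LT1 _] := hC _ Lfb; have [LT2 _] := hC _ Lfg.
    apply: le_trans (cmodD _ _) _; rewrite mulrDr; apply: lerD.
      apply: le_trans (inner_le LT1 Lg) _; rewrite mulrA ler_wpM2r//; exact: hM.
    apply: le_trans (inner_le LT2 Lgb) _; rewrite mulrA ler_wpM2r ?norm2_ge0//.
    by apply: le_trans (hM _ Lfg) _; rewrite ler_wpM2l// le_norm.
have finf p : Ff p \is a fin_num by exact: fin.
have fing p : Fg p \is a fin_num by exact: fin.
have Ef : (\int[P]_w \int[P]_w' Ff (w, w') <= (delta ^+ 2 * a ^+ 2)%:E)%E.
  by rewrite (norm2_sqr Lf); exact: (mean_bad_energy oH Lf bad_prob hP).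
have Eg : (\int[P]_w \int[P]_w' Fg (w, w') <= (delta ^+ 2 * b ^+ 2)%:E)%E.
  by rewrite (norm2_sqr Lg); exact: (mean_bad_energy oH Lg bad_prob hP).
have V0 w1 w2 : 0 <= V w1 w2 by exact: cmod_ge0.
have -> : (fun w1 => itint (fun w2 => (cmod (inner mu (intop mu K (fbad w1 w2)) g +
  inner mu (intop mu K (fgood w1 w2)) (gbad w1 w2)))%:E)) = (fun w1 => itint (fun w2 => (V w1 w2)%:E)) by [].
clearbody Ff Fg V a b; clear fin bad_prob hfbad hfgood hgbad hM hC.
(* The choices [s = delta * a] and [s = delta * b] in [le_div2] need both norms positive. Otherwise
   [x * b + a * y <= 2 * (a * b) = 0], so the integrand vanishes. *)
have [ab0|abn0] := eqVneq (a * b) 0.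
  rewrite ab0 mule0 -(integral0 (P \x P)%E setT).
  apply: (le_itint2 hP (V := fun w1 w2 => (V w1 w2)%:E)) => // w1 w2 O1 O2; rewrite !lee_fin V0 /=.
  have [x [y [/andP[x0 xa] /andP[y0 yb] _ _ le]]] := bound w1 w2 O1 O2.
  apply: le_trans le _; rewrite -(mulr0 M) ler_wpM2l//.
  have := ler_wpM2r b0 xa; have := ler_wpM2l a0 yb; lra.
have a1 : 0 < a by rewrite lt_neqAle a0 andbT eq_sym; apply: contra_neq abn0 => ->; rewrite mul0r.
have b1 : 0 < b by rewrite lt_neqAle b0 andbT eq_sym; apply: contra_neq abn0 => ->; rewrite mulr0.
(* These are the coefficients that [le_div2] gives to the two energies, while [k0] collects its
   constant terms. In the mean each energy term is at most [k0 / 2], so the total is [2 * k0]. *)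
pose ka := M * b / (2 * (delta * a)); pose kb := M * a / (2 * (delta * b)).
have ka0 : 0 <= ka by rewrite divr_ge0 ?mulr_ge0// ltW.
have kb0 : 0 <= kb by rewrite divr_ge0 ?mulr_ge0// ltW.
pose k0 := M * delta * a * b.
have k00 : 0 <= k0 by rewrite !mulr_ge0// ltW.
pose Fgs (p : d.-tuple R * d.-tuple R) := Fg (p.2, p.1).
have mFgs : measurable_fun setT Fgs by exact: (measurableT_comp mFg (@measurable_swap _ _ _ _)).
have m1 : measurable_fun setT (fun p => ka%:E * Ff p)%E by exact: measurable_funeM.
have m2 : measurable_fun setT (fun p => kb%:E * Fgs p)%E by exact: measurable_funeM.
have m12 : measurable_fun setT (fun p => ka%:E * Ff p + kb%:E * Fgs p)%E by exact: emeasurable_funD.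
have p1 p : (0 <= ka%:E * Ff p)%E by apply: mule_ge0; rewrite ?lee_fin.
have p2 p : (0 <= kb%:E * Fgs p)%E by apply: mule_ge0; rewrite ?lee_fin//; exact: Fg0.
have p12 p : (0 <= ka%:E * Ff p + kb%:E * Fgs p)%E by exact: adde_ge0.
apply: (@le_trans _ _ (\int[P \x P]_p (k0%:E + (ka%:E * Ff p + kb%:E * Fgs p)))%E).
  apply: (le_itint2 hP (V := fun w1 w2 => (V w1 w2)%:E)).
  - exact: emeasurable_funD.
  - by move=> p; apply: adde_ge0 => //; rewrite lee_fin.
  move=> w1 w2 O1 O2; rewrite lee_fin V0 /=.
  have [x [y [/andP[x0 xa] /andP[y0 yb] xf yg le]]] := bound w1 w2 O1 O2.
  rewrite /Fgs /= -[Ff _]fineK// -[Fg _]fineK//.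
  rewrite -!EFinM -!EFinD lee_fin; apply: le_trans le _.
  have hx := le_div2 (mulr_gt0 delta0 a1) xf.
  have hy := le_div2 (mulr_gt0 delta0 b1) yg.
  set ef := fine _ in hx *; set eg := fine _ in hy *.
  have -> : k0 + (ka * ef + kb * eg) = M * ((ef / (2 * (delta * a)) + delta * a / 2) * b +
      a * (eg / (2 * (delta * b)) + delta * b / 2)).
    by rewrite /k0 /ka /kb; field; rewrite !gt_eqF.
  by rewrite ler_wpM2l// lerD// ?ler_wpM2r// ler_wpM2l.
rewrite ge0_integralD//.
rewrite ge0_integralD// ge0_integralZl// ge0_integralZl//; last by move=> p _; exact: Fg0.
rewrite integral_cst// [X in (_ * X)%E]probability_setT mule1.
have If : (\int[P \x P]_p Ff p <= (delta ^+ 2 * a ^+ 2)%:E)%E.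
  by rewrite fubini_tonelli1.
(* For [g] the shift of its own lattice is the second coordinate, so Tonelli is used in the other
   order. *)
have Ig : (\int[P \x P]_p Fgs p <= (delta ^+ 2 * b ^+ 2)%:E)%E.
  by rewrite fubini_tonelli2// => p; exact: Fg0.
apply: (@le_trans _ _ (k0%:E + (ka%:E * (delta ^+ 2 * a ^+ 2)%:E + kb%:E * (delta ^+ 2 * b ^+ 2)%:E))%E).
  by rewrite leeD2l// leeD// lee_wpmul2l// lee_fin.
rewrite -!EFinM -!EFinD lee_fin le_eqVlt; apply/orP; left; apply/eqP.
by rewrite /k0 /ka /kb; field; rewrite !gt_eqF.
Qed.
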